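(* Let $A$ be a linear operator on a Hilbert space $H$. Assume that there exist a countable (not necessarily complete) orthonormal system $\{e_k\}_{k\in\mathbb{N}}$ in $H$ and an unbounded sequence $\{\lambda_k\}$ of positive real numbers such that $Ae_k=\lambda_k^{2}e_k$ for every $k\in\mathbb{N}$. Let $\sigma\in[0,1/2)$ and $\delta>0$ be real numbers. Let $\omega:[0,+\infty)\to[0,+\infty)$ be a continuity modulus such that $$\lim_{\varepsilon\to0^{+}}\frac{\omega(\varepsilon)}{\varepsilon^{1-2\sigma}}=+\infty.$$ Let $\varphi:(0,+\infty)\to(0,+\infty)$ and $\psi:(0,+\infty)\to(0,+\infty)$ be two functions such that $$\lim_{x\to+\infty}\frac{x}{\varphi(x)}\,\omega\left(\frac1x\right)=\lim_{x\to+\infty}\frac{x}{\psi(x)}\,\omega\left(\frac1x\right)=+\infty.$$ Then there exist a function $c:\mathbb{R}\to\mathbb{R}$ such that $$\frac12\le c(t)\le\frac32\quad\forall t\in\mathbb{R},\qquad|c(t)-c(s)|\le\omega(|t-s|)\quad\forall(t,s)\in\mathbb{R}^{2},$$ and a solution $u(t)$ to the equation $$u''(t)+2\delta A^{\sigma}u'(t)+c(t)Au(t)=0$$ such that $$(u(0),u'(0))\in\mathcal{G}_{\varphi,r,1/2}(A)\times\mathcal{G}_{\varphi,r,0}(A)\qquad\forall r>0,$$ $$(u(t),u'(t))\notin\mathcal{G}_{-\psi,R,1/2}(A)\times\mathcal{G}_{-\psi,R,0}(A)\qquad\forall R>0,\ \forall t>0.$$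
   Context: Continuity modulus: a continuous function $\omega:[0,+\infty)\to[0,+\infty)$ such that $\omega(0)=0$, $\omega(x)>0$ for every $x>0$, $x\mapsto\omega(x)$ is nondecreasing, and $x\mapsto x/\omega(x)$ is nondecreasing (on $x>0$). Spaces. A (generalized) vector $u=\sum_ku_ke_k$ is identified with the sequence $\{u_k\}$ of real numbers (its components with respect to $\{e_k\}$), with no summability required a priori. For $r\ge0$, $R\ge0$, $\alpha\in\mathbb{R}$: - $u\in\mathcal{G}_{\varphi,r,\alpha}(A)$ (generalized Gevrey space) if $\sum_k(1+\lambda_k)^{4\alpha}u_k^{2}\exp(2r\varphi(\lambda_k))<+\infty$; - $u\in\mathcal{G}_{-\psi,R,\alpha}(A)$ (generalized Gevrey ultradistributions) if $\sum_k(1+\lambda_k)^{4\alpha}u_k^{2}\exp(-2R\psi(\lambda_k))<+\infty$. Solution. A solution $u(t)=\sum_ku_k(t)e_k$ of the equation is understood componentwise: each real-valued $u_k$ satisfies $u_k''(t)+2\delta\lambda_k^{2\sigma}u_k'(t)+\lambda_k^{2}c(t)u_k(t)=0$ for all $t\ge0$, and $u'(t)=\sum_ku_k'(t)e_k$. (With the given regularity of $c$ and of the initial data, this is the unique solution with values in suitable spaces of ultradistributions.) *)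

(* Defs.v *)
From Stdlib Require Import Reals.
From Coquelicot Require Import Coquelicot.
Open Scope R_scope.

(** A real Hilbert space is a [CompleteNormedModule R_AbsRing] whose norm comes
    from an inner product; positive definiteness follows from [ip_norm]. *)
Record is_inner_product (H : NormedModule R_AbsRing) (ip : H -> H -> R) : Prop := {
  ip_sym : forall x y, ip x y = ip y x;
  ip_plus : forall x y z, ip (plus x y) z = ip x z + ip y z;
  ip_scal : forall (a : R) x y, ip (scal a x) y = a * ip x y;
  ip_norm : forall x, ip x x = norm x ^ 2
}.

(** Possibly unbounded and not everywhere defined: the values of [op] outside
    [dom] carry no meaning. *)
Record linear_operator (H : ModuleSpace R_AbsRing) := {
  dom : H -> Prop;
  op : H -> H;
  dom_zero : dom zero;
  dom_plus : forall x y, dom x -> dom y -> dom (plus x y);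
  dom_scal : forall (a : R) x, dom x -> dom (scal a x);
  op_plus : forall x y, dom x -> dom y -> op (plus x y) = plus (op x) (op y);
  op_scal : forall (a : R) x, dom x -> op (scal a x) = scal a (op x)
}.
Arguments dom {H} _ _.
Arguments op {H} _ _.

Definition orthonormal {H : Type} (ip : H -> H -> R) (e : nat -> H) : Prop :=
  forall i j, ip (e i) (e j) = if Nat.eqb i j then 1 else 0.

Definition unbounded_seq (lambda : nat -> R) : Prop :=
  forall M, exists k, M < lambda k.

(** Functions on a half-line are total functions on [R] of which only the
    restriction to that half-line is constrained. *)
Record continuity_modulus (omega : R -> R) : Prop := {
  cm_nonneg : forall x, 0 <= x -> 0 <= omega x;
  cm_continuous : continuous_on (fun x => 0 <= x) omega;
  cm_zero : omega 0 = 0;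
  cm_pos : forall x, 0 < x -> 0 < omega x;
  cm_nondecr : forall x y, 0 <= x -> x <= y -> omega x <= omega y;
  cm_ratio_nondecr :
    forall x y, 0 < x -> x <= y -> x / omega x <= y / omega y
}.

(** A generalized vector [sum_k u_k e_k] is its sequence of components. *)
Definition gevrey (lambda : nat -> R) (phi : R -> R) (r alpha : R)
    (u : nat -> R) : Prop :=
  ex_series (fun k => Rpower (1 + lambda k) (4 * alpha) * u k ^ 2
                      * exp (2 * r * phi (lambda k))).

Definition gevrey_ultra (lambda : nat -> R) (psi : R -> R) (r alpha : R)
    (u : nat -> R) : Prop :=
  ex_series (fun k => Rpower (1 + lambda k) (4 * alpha) * u k ^ 2
                      * exp (- 2 * r * psi (lambda k))).

(** [u'' + 2 delta A^sigma u' + c(t) A u = 0] for [t >= 0], componentwise, with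
    [A e_k = lambda_k ^ 2 e_k].  The derivatives at [t = 0] are two-sided: as
    [c] is defined on all of [R], a solution on the half-line extends to the
    left of [0]. *)
Definition is_solution (delta sigma : R) (lambda : nat -> R) (c : R -> R)
    (u : nat -> R -> R) : Prop :=
  forall k t, 0 <= t ->
    ex_derive (u k) t /\
    ex_derive (Derive (u k)) t /\
    Derive (Derive (u k)) t
      + 2 * delta * Rpower (lambda k) (2 * sigma) * Derive (u k) t
      + lambda k ^ 2 * c t * u k t = 0.

(* Main.v *)
Require Import Defs.
From Stdlib Require Import Reals Lra Lia Classical IndefiniteDescription.
From Coquelicot Require Import Coquelicot.
Open Scope R_scope.

(** Only a sparse subsequence l_k of the frequencies is excited.  The speed is
    c = 1 + sum_k g_k, where g_k lives in the dyadic interval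
    [2^-(k+1), 2^-k], oscillates there in parametric resonance with the k-th
    mode, and has amplitude of order eps_k = 2^-(k+1) omega(1/l_k) / 80; this
    amplitude is what the modulus omega allows at the scale 1/l_k.  During its
    own interval the k-th mode is explicit and its energy is multiplied by
    exp(2 X_k), X_k of order 4^-k l_k omega(1/l_k), which exceeds any multiple of
    phi(l_k), psi(l_k) and of the loss l_k^(2 sigma) due to damping when l_k is
    large.  Before that interval c - 1 is of size 1/l_k, because the later
    modes are chosen with omega(1/l_j) much smaller than 1/l_k; after it c is
    Lipschitz with a constant depending only on the earlier modes.  In both
    regimes the energy is almost conserved, so normalizing the energy to
    exp(-X_k) before and exp(X_k) after resonance gives the theorem. *)

(** * Energy estimate *)

Lemma ex_derive_continuity_pt (f : R -> R) (x : R) :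
  ex_derive f x -> continuity_pt f x.
Proof.
  intros Hf. apply derivable_continuous_pt. now apply ex_derive_Reals_0.
Qed.

(** Nonnegative lower Dini derivatives, written without quotients so that both sides of [t] are
    covered at once. No differentiability of [G] is available, because the energy below contains a
    coefficient that is merely Lipschitz. The proof is a supremum argument for [G] with an extra
    slope [eta], which is then removed. *)
Lemma nondecreasing_of_lower_slope (G : R -> R) (a b : R) :
  a <= b ->
  (forall t eta, a <= t <= b -> 0 < eta ->
     exists d, 0 < d /\ forall s, a <= s <= b -> Rabs (s - t) < d ->
       - eta * (s - t) ^ 2 <= (s - t) * (G s - G t)) ->
  G a <= G b.
Proof.
  intros Hab HG.
  assert (Hslope : forall eta, 0 < eta -> G a - eta * (b - a) <= G b).
  { intros eta Heta.
    set (S := fun x => a <= x <= b /\ G a - eta * (x - a) <= G x).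
    assert (Sa : S a) by (split; lra).
    destruct (completeness S) as [m [Hub Hlub]].
    { exists b; intros x [Hx _]; lra. }
    { now exists a. }
    assert (Ham : a <= m) by now apply Hub.
    assert (Hmb : m <= b) by (apply Hlub; intros x [Hx _]; lra).
    destruct (HG m eta (conj Ham Hmb) Heta) as [d [Hd Hm]].
    (* The slope condition to the left of [m] carries the inequality from nearby points of [S] to
       [m]; the condition to the right, used afterwards, pushes it beyond [m]. *)
    assert (Sm : S m).
    { split; [lra|].
      destruct (classic (exists x, S x /\ m - d < x)) as [[x [Sx Hx]]|Hno].
      - assert (Hxm := Hub x Sx). destruct Sx as [Hxab Sx].
        destruct (Req_dec x m) as [->|Hne]; [exact Sx|].
        assert (Hlt : Rabs (x - m) < d) by (rewrite Rabs_left; lra).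
        specialize (Hm x Hxab Hlt). nra.
      - exfalso.
        assert (m <= m - d); [|lra].
        apply Hlub. intros x Sx. apply Rnot_lt_le. intros Hlt. apply Hno. now exists x. }
    destruct (Req_dec m b) as [<-|Hne]; [now apply Sm|].
    exfalso.
    set (s := Rmin (m + d / 2) b).
    assert (Hs : m < s <= b /\ s <= m + d / 2)
      by (unfold s, Rmin; destruct Rle_dec; lra).
    assert (Hlt : Rabs (s - m) < d) by (rewrite Rabs_right; lra).
    assert (Hsab : a <= s <= b) by lra.
    specialize (Hm s Hsab Hlt). destruct Sm as [_ Sm].
    assert (S s) by (split; [lra|nra]).
    specialize (Hub s H). lra. }
  apply Rnot_lt_le. intros Hlt.
  assert (Hba : 0 < b - a + 1) by lra.
  (* The summand 1 keeps the denominator positive when [a = b] and makes [eta * (b - a)] strictly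
     smaller than [G a - G b]. *)
  specialize (Hslope ((G a - G b) / (b - a + 1))).
  assert (0 < (G a - G b) / (b - a + 1)) by (apply Rdiv_lt_0_compat; lra).
  specialize (Hslope H).
  assert (Hmul : (G a - G b) / (b - a + 1) * (b - a + 1) = G a - G b) by (field; lra).
  nra.
Qed.

(* The derivative of the energy only sees the variation of [h1], so [h1] has
   to be Lipschitz but not small; the contribution of [h2] is controlled by its
   size. *)
Lemma energy_backward (Q l L kappa a b : R) (h1 h2 y y1 : R -> R) :
  a <= b -> 0 < l -> 0 <= L -> 0 <= kappa -> 3 / 4 * l ^ 2 <= Q ->
  (forall t, a <= t <= b -> Rabs (h1 t) <= 1 / 4) ->
  (forall t s, a <= t <= b -> a <= s <= b ->
     Rabs (h1 t - h1 s) <= L * Rabs (t - s)) ->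
  (forall t, a <= t <= b -> Rabs (h2 t) <= kappa) ->
  (forall t, a <= t <= b -> is_derive y t (y1 t)) ->
  (forall t, a <= t <= b ->
     is_derive y1 t (- (Q + l ^ 2 * (h1 t + h2 t)) * y t)) ->
  y1 a ^ 2 + (Q + l ^ 2 * h1 a) * y a ^ 2
  <= exp (2 * (l * kappa + L) * (b - a))
     * (y1 b ^ 2 + (Q + l ^ 2 * h1 b) * y b ^ 2).
Proof.
  intros Hab Hl HL Hk HQ Hh1 Hlip Hh2 Hy Hy1.
  set (K := 2 * (l * kappa + L)).
  set (F := fun t => y1 t ^ 2 + (Q + l ^ 2 * h1 t) * y t ^ 2).
  assert (HG : exp (K * a) * F a <= exp (K * b) * F b).
  { apply (nondecreasing_of_lower_slope (fun t => exp (K * t) * F t)); [exact Hab|].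
    intros t eta Ht Heta.
    (* [A] freezes [h1] at time [t] and is therefore differentiable; what is left of the weighted
       energy increment is [(h1 s - h1 t) * B s], at worst [L * B] per unit of time. *)
    set (A := fun s => exp (K * s) * (y1 s ^ 2 + (Q + l ^ 2 * h1 t) * y s ^ 2)).
    set (B := fun s => exp (K * s) * (l ^ 2 * y s ^ 2)).
    set (A' := exp (K * t) * (K * F t - 2 * l ^ 2 * h2 t * y t * y1 t)).
    assert (HA : is_derive A t A').
    { unfold A, A', F. specialize (Hy t Ht). specialize (Hy1 t Ht).
      auto_derive.
      - repeat split; [now exists (- (Q + l ^ 2 * (h1 t + h2 t)) * y t)|now exists (y1 t)].
      - assert (E : Derive (fun x : R => y x) t = y1 t) by exact (is_derive_unique _ _ _ Hy).
        assert (E1 : Derive (fun x : R => y1 x) t = - (Q + l ^ 2 * (h1 t + h2 t)) * y t)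
          by exact (is_derive_unique _ _ _ Hy1).
        rewrite E, E1. ring. }
    assert (HB : continuity_pt B t).
    { apply ex_derive_continuity_pt.
      unfold B. specialize (Hy t Ht). auto_derive. now exists (y1 t). }
    (* The energy is at least [y1 ^ 2 + l ^ 2 y ^ 2 / 2]. Hence the part [2 L] of [K] pays for the
       variation of [h1], and the part [2 l kappa] pays for the cross term with [h2]. *)
    assert (HAB : L * B t <= A').
    { unfold A', B, F, K. specialize (Hh1 t Ht). specialize (Hh2 t Ht).
      apply Rabs_le_between in Hh1. apply Rabs_le_between in Hh2.
      assert (He := exp_pos (2 * (l * kappa + L) * t)).
      rewrite <- Rmult_assoc, (Rmult_comm L), Rmult_assoc.
      apply Rmult_le_compat_l; [lra|].
      assert (Hlo : y1 t ^ 2 + l ^ 2 / 2 * y t ^ 2 <= y1 t ^ 2 + (Q + l ^ 2 * h1 t) * y t ^ 2).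
      { apply Rplus_le_compat_l, Rmult_le_compat_r; [apply pow2_ge_0|].
        assert (0 <= l ^ 2) by apply pow2_ge_0. nra. }
      assert (Hlk : 0 <= l * kappa) by nra.
      assert (H2 : (2 * (l * kappa + L)) * (y1 t ^ 2 + l ^ 2 / 2 * y t ^ 2)
        <= (2 * (l * kappa + L)) * (y1 t ^ 2 + (Q + l ^ 2 * h1 t) * y t ^ 2))
        by (apply Rmult_le_compat_l; lra).
      set (z := l * y t) in *.
      assert (H3 : 2 * l * h2 t * (z * y1 t) <= 2 * (l * kappa) * (y1 t ^ 2 + z ^ 2 / 2)).
      { apply Rle_trans with (2 * l * (kappa * Rabs (z * y1 t))).
        - rewrite 2!Rmult_assoc, (Rmult_assoc 2 l). do 2 (apply Rmult_le_compat_l; [lra|]).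
          apply Rle_trans with (Rabs (h2 t * (z * y1 t))); [apply Rle_abs|].
          rewrite Rabs_mult. apply Rmult_le_compat_r; [apply Rabs_pos|].
          apply Rabs_le; lra.
        - replace (2 * l * (kappa * Rabs (z * y1 t))) with (2 * (l * kappa) * Rabs (z * y1 t)) by ring.
          apply Rmult_le_compat_l; [lra|]. apply Rabs_le. split; nra. }
      assert (H4 : 0 <= 2 * L * y1 t ^ 2) by (assert (0 <= y1 t ^ 2) by apply pow2_ge_0; nra).
      unfold z in H3. nra. }
    apply is_derive_Reals in HA.
    destruct (HA (eta / 2)) as [d1 Hd1]; [lra|].
    destruct (HB (eta / (2 * (L + 1)))) as [d2 [Hd2 HB2]];
      [apply Rdiv_lt_0_compat; lra|].
    exists (Rmin d1 d2). split; [apply Rmin_pos; [apply cond_pos|exact Hd2]|].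
    intros s Hs Hst.
    destruct (Req_dec s t) as [->|Hne]; [lra|].
    assert (Hst1 : Rabs (s - t) < d1) by (eapply Rlt_le_trans; [exact Hst|apply Rmin_l]).
    assert (Hst2 : Rabs (s - t) < d2) by (eapply Rlt_le_trans; [exact Hst|apply Rmin_r]).
    assert (HAs : Rabs ((A s - A t) / (s - t) - A') < eta / 2).
    { specialize (Hd1 (s - t)). replace (t + (s - t)) with s in Hd1 by ring.
      apply Hd1; [lra|exact Hst1]. }
    assert (HBs : Rabs (B s - B t) < eta / (2 * (L + 1))).
    { apply (HB2 s). split; [|exact Hst2]. split; [exact I|lra]. }
    assert (HLB : L * B s <= L * B t + eta / 2).
    { apply Rabs_lt_between in HBs.
      assert (HLe : (L + 1) * (eta / (2 * (L + 1))) = eta / 2) by (field; lra).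
      assert (0 < eta / (2 * (L + 1))) by (apply Rdiv_lt_0_compat; lra).
      nra. }
    assert (HB0 : 0 <= B s).
    { unfold B. assert (He := exp_pos (K * s)).
      assert (0 <= (l * y s) ^ 2) by apply pow2_ge_0. nra. }
    replace (exp (K * s) * F s - exp (K * t) * F t)
      with ((A s - A t) / (s - t) * (s - t) + (h1 s - h1 t) * B s)
      by (unfold A, B, F; field; lra).
    apply Rabs_lt_between in HAs.
    assert (Hsq : 0 < (s - t) ^ 2) by (apply pow2_gt_0; lra).
    assert (Hh : - (L * (s - t) ^ 2) <= (s - t) * (h1 s - h1 t)).
    { specialize (Hlip s t Hs Ht).
      assert (Rabs ((s - t) * (h1 s - h1 t)) <= L * (s - t) ^ 2).
      { rewrite Rabs_mult, <- (pow2_abs (s - t)).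
        assert (H0 := Rabs_pos (s - t)). nra. }
      apply Rabs_le_between in H. lra. }
    assert (H1 : (A' - eta / 2) * (s - t) ^ 2 <= (A s - A t) / (s - t) * (s - t) ^ 2)
      by (apply Rmult_le_compat_r; lra).
    assert (H2 : - (L * (s - t) ^ 2) * B s <= (s - t) * (h1 s - h1 t) * B s)
      by (apply Rmult_le_compat_r; lra).
    assert (H3 : L * B s * (s - t) ^ 2 <= (A' + eta / 2) * (s - t) ^ 2)
      by (apply Rmult_le_compat_r; lra).
    nra. }
  apply Rmult_le_reg_l with (exp (K * a)); [apply exp_pos|].
  rewrite <- Rmult_assoc, <- exp_plus.
  replace (K * a + K * (b - a)) with (K * b) by ring.
  exact HG.
Qed.

(** * Linear second-order equations with bounded continuous coefficient *)

Lemma exp_le (x y : R) : x <= y -> exp x <= exp y.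
Proof.
  intros [Hxy| ->]; [left; now apply exp_increasing|right; reflexivity].
Qed.

(** * Series with geometric bounds and their termwise differentiation *)

Lemma Series_eq_single (f : nat -> R) (k : nat) :
  (forall j, j <> k -> f j = 0) -> Series f = f k.
Proof.
  intros Hf.
  rewrite (Series_incr_n_aux f k) by (intros j Hj; apply Hf; lia).
  rewrite Series_incr_1.
  - rewrite Nat.add_0_r.
    rewrite (Series_ext _ (fun _ => 0 * 0)), Series_scal_l; [ring|].
    intros n. rewrite Hf by lia. ring.
  - apply (ex_series_incr_1 (fun j => f (k + j)%nat)).
    apply (ex_series_ext (fun n => scal 0 (0 ^ n))).
    + intros n. rewrite Hf by lia. apply Rmult_0_l.
    + apply (ex_series_scal_l 0 (fun n => 0 ^ n)). apply ex_series_geom. rewrite Rabs_R0. lra.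
Qed.

(** The weights [(1 / 2) ^ S n] sum to exactly 1, so a termwise bound passes to the sum with the
    same constant. This is why later estimates carry this weight. *)
Lemma Series_geom_bound (f : nat -> R) (C : R) :
  (forall n, Rabs (f n) <= C * (1 / 2) ^ S n) ->
  ex_series f /\ Rabs (Series f) <= C.
Proof.
  intros Hf.
  assert (Hg : is_series (fun n => C * (1 / 2) ^ S n) C).
  { assert (H12 : Rabs (1 / 2) < 1) by (rewrite Rabs_right; lra).
    assert (Hs := is_series_scal_l (V := R_NormedModule) (C / 2) _ _ (is_series_geom (1 / 2) H12)).
    assert (E : C / 2 * / (1 - 1 / 2) = C) by field.
    change (is_series (fun n => C / 2 * (1 / 2) ^ n) (C / 2 * / (1 - 1 / 2))) in Hs.
    rewrite E in Hs. revert Hs. apply is_series_ext. intros n.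
    change (C / 2 * (1 / 2) ^ n = C * (1 / 2 * (1 / 2) ^ n)). field. }
  assert (Hex : ex_series (fun n => Rabs (f n))).
  { apply (ex_series_le (K := R_AbsRing) (V := R_CompleteNormedModule))
      with (b := fun n => C * (1 / 2) ^ S n); [|now exists C].
    intros n. unfold norm; simpl. unfold abs; simpl. rewrite Rabs_Rabsolu. apply Hf. }
  split; [now apply ex_series_Rabs|].
  apply Rle_trans with (Series (fun n => Rabs (f n))); [now apply Series_Rabs|].
  rewrite <- (is_series_unique _ _ Hg).
  apply Series_le; [|now exists C].
  intros n. split; [apply Rabs_pos|apply Hf].
Qed.

Lemma CVU_Series_geom (f : nat -> R -> R) (C x0 : R) (r : posreal) :
  (forall n x, Boule x0 r x -> Rabs (f n x) <= C * (1 / 2) ^ S n) ->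
  CVU (fun n x => sum_f_R0 (fun i => f i x) n) (fun x => Series (fun i => f i x)) x0 r.
Proof.
  intros Hf eps Heps.
  assert (HC : 0 <= C).
  { assert (Hx : Boule x0 r x0).
    { unfold Boule. rewrite Rminus_diag, Rabs_R0. apply cond_pos. }
    specialize (Hf O x0 Hx). assert (H := Rabs_pos (f O x0)). simpl in Hf. lra. }
  destruct (pow_lt_1_zero (1 / 2) ltac:(rewrite Rabs_right; lra) (eps / (C + 1))) as [N HN].
  { apply Rdiv_lt_0_compat; lra. }
  exists N. intros n x Hn Hx.
  assert (Hex : ex_series (fun i => f i x)) by (apply (Series_geom_bound _ C); auto).
  rewrite (Series_incr_n _ (S n) ltac:(lia) Hex). simpl Init.Nat.pred.
  replace (sum_f_R0 (fun i => f i x) n + Series (fun k => f (S n + k)%nat x)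
           - sum_f_R0 (fun i => f i x) n)
    with (Series (fun k => f (S n + k)%nat x)) by ring.
  apply Rle_lt_trans with (C * (1 / 2) ^ S n).
  - apply Series_geom_bound. intros k.
    rewrite Rmult_assoc, <- pow_add.
    replace (S n + S k)%nat with (S (S n + k)) by lia. auto.
  - specialize (HN (S n) ltac:(lia)).
    assert (Hp : 0 < (1 / 2) ^ S n) by (apply pow_lt; lra).
    rewrite Rabs_right in HN by lra.
    assert (He : eps / (C + 1) * (C + 1) = eps) by (field; lra).
    nra.
Qed.

Lemma is_derive_Series_geom (f f' : nat -> R -> R) (x0 : R) :
  (forall n x, is_derive (f n) x (f' n x)) ->
  (forall r, 0 < r -> exists C, forall n x, Rabs (x - x0) < r ->
     Rabs (f n x) <= C * (1 / 2) ^ S n /\ Rabs (f' n x) <= C * (1 / 2) ^ S n) ->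
  forall x, is_derive (fun x => Series (fun n => f n x)) x (Series (fun n => f' n x)).
Proof.
  intros Hf Hb x.
  set (r := mkposreal (Rabs (x - x0) + 1) ltac:(assert (H := Rabs_pos (x - x0)); lra)).
  destruct (Hb r (cond_pos r)) as [C HC].
  assert (Hx : Boule x0 r x) by (unfold Boule; simpl; lra).
  apply is_derive_Reals.
  apply (CVU_derivable (fun n x => sum_f_R0 (fun i => f i x) n)
           (fun n x => sum_f_R0 (fun i => f' i x) n)
           (fun x => Series (fun n => f n x)) (fun x => Series (fun n => f' n x)) x0 r).
  - apply (CVU_Series_geom f' C). intros n z Hz. now apply HC.
  - apply CVU_cv, (CVU_Series_geom f C). intros n z Hz. now apply HC.
  - intros n z _. induction n as [|n IH]; simpl.
    + apply is_derive_Reals, Hf.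
    + apply derivable_pt_lim_plus; [exact IH|]. apply is_derive_Reals, Hf.
  - exact Hx.
Qed.

(** Two mean value steps give [f x - f x0 = f2 w * ((z - x0) * (x - x0))] with [z] between [x0] and
    [x]. *)
Lemma min_of_convex (f f1 f2 : R -> R) (x0 : R) :
  (forall x, is_derive f x (f1 x)) -> (forall x, is_derive f1 x (f2 x)) ->
  f1 x0 = 0 -> (forall x, 0 <= f2 x) -> forall x, f x0 <= f x.
Proof.
  intros Hf Hf1 H0 Hpos x.
  assert (Hc : forall z, continuity_pt f z)
    by (intros z; apply ex_derive_continuity_pt; now exists (f1 z)).
  assert (Hc1 : forall z, continuity_pt f1 z)
    by (intros z; apply ex_derive_continuity_pt; now exists (f2 z)).
  destruct (MVT_gen f x0 x f1) as [z [Hz Hfz]]; auto.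
  destruct (MVT_gen f1 x0 z f2) as [w [Hw Hfw]]; auto.
  rewrite H0, Rminus_0_r in Hfw.
  assert (0 <= (z - x0) * (x - x0)).
  { revert Hz. unfold Rmin, Rmax. destruct Rle_dec; intros; nra. }
  specialize (Hpos w).
  assert (f x - f x0 = f2 w * ((z - x0) * (x - x0))) by (rewrite Hfz, Hfw; ring).
  nra.
Qed.

Lemma is_derive_RInt_continuous (f : R -> R) (a x : R) :
  (forall z, continuity_pt f z) -> is_derive (fun x => RInt f a x) x (f x).
Proof.
  intros Hf.
  apply (is_derive_RInt f _ a).
  - apply filter_forall. intros z. apply (RInt_correct (V := R_CompleteNormedModule)), (ex_RInt_continuous (V := R_CompleteNormedModule)).
    intros w _. apply continuity_pt_filterlim, Hf.
  - apply continuity_pt_filterlim, Hf.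
Qed.

(** * Picard series for [y'' = - q y] on the whole line *)

Section Picard.

Variables (q : R -> R) (B t0 y0 v0 : R).
Hypothesis q_cont : forall t, continuity_pt q t.
Hypothesis q_bound : forall t, Rabs (q t) <= B.

(** These are the increments of the Picard iteration, not the iterates: term 0 is affine and the
    second derivative of each later term is [- q] times the preceding one, so the sum of all terms
    is the solution. *)
Fixpoint picard_term (n : nat) : R -> R :=
  match n with
  | O => fun t => y0 + v0 * (t - t0)
  | S m => fun t => RInt (fun s => RInt (fun r => - q r * picard_term m r) t0 s) t0 t
  end.

Definition picard_slope (n : nat) : R -> R :=
  match n with
  | O => fun _ => v0
  | S m => fun s => RInt (fun r => - q r * picard_term m r) t0 s
  end.

Definition picard_accel (n : nat) : R -> R :=
  match n with
  | O => fun _ => 0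
  | S m => fun t => - q t * picard_term m t
  end.

Lemma picard_term_slope n :
  (forall t, is_derive (picard_term n) t (picard_slope n t)) /\
  (forall t, is_derive (picard_slope n) t (picard_accel n t)).
Proof.
  induction n as [|n [IH _]].
  - split; intros t; simpl; auto_derive; auto; ring.
  - assert (Hs : forall t, is_derive (picard_slope (S n)) t (picard_accel (S n) t)).
    { intros t. apply (is_derive_RInt_continuous (fun r => - q r * picard_term n r)).
      intros z. apply continuity_pt_mult.
      - apply continuity_pt_opp, q_cont.
      - apply ex_derive_continuity_pt. eexists. apply IH. }
    split; [|exact Hs].
    intros t. apply (is_derive_RInt_continuous (picard_slope (S n))).
    intros z. apply ex_derive_continuity_pt. eexists. apply Hs.
Qed.

Let m := 1 + 2 * B.
Let W t := exp (m * (t - t0)) + exp (- m * (t - t0)).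
Let M := 2 * (Rabs y0 + Rabs v0).

Lemma picard_B_pos : 0 <= B.
Proof. apply Rle_trans with (Rabs (q 0)); [apply Rabs_pos|apply q_bound]. Qed.

(* [W'' = m ^ 2 W] with [m ^ 2 >= 2 B], so by convexity each Picard step halves
   the bound. *)
Lemma picard_term_bound n t : Rabs (picard_term n t) <= M * (1 / 2) ^ S n * W t.
Proof.
  assert (HB := picard_B_pos).
  assert (Hm : 1 <= m) by (unfold m; lra).
  assert (Hy0 := Rabs_pos y0). assert (Hv0 := Rabs_pos v0).
  revert t. induction n as [|n IH]; intros t.
  - simpl picard_term.
    assert (HW : 1 <= W t /\ Rabs (t - t0) <= W t).
    { unfold W.
      assert (H1 := exp_ineq1_le (m * (t - t0))). assert (H2 := exp_ineq1_le (- m * (t - t0))).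
      assert (H3 := exp_pos (m * (t - t0))). assert (H4 := exp_pos (- m * (t - t0))).
      split; [lra|]. apply Rabs_le. split; destruct (Rle_dec 0 (t - t0)); nra. }
    eapply Rle_trans; [apply Rabs_triang|]. rewrite Rabs_mult.
    unfold M. simpl. assert (H := Rabs_pos (t - t0)). nra.
  - set (C := M * (1 / 2) ^ S (S n)).
    assert (HC : 0 <= C).
    { unfold C, M. apply Rmult_le_pos; [lra|]. apply pow_le; lra. }
    destruct (picard_term_slope (S n)) as [H1 H2].
    assert (Hz : picard_term (S n) t0 = 0) by (simpl; now rewrite RInt_point).
    assert (Hz1 : picard_slope (S n) t0 = 0) by (simpl; now rewrite RInt_point).
    assert (Hacc : forall x, Rabs (picard_accel (S n) x) <= C * m ^ 2 * W x).
    { intros x. simpl picard_accel. rewrite Rabs_mult, Rabs_Ropp.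
      apply Rle_trans with (B * (M * (1 / 2) ^ S n * W x)).
      - apply Rmult_le_compat; try apply Rabs_pos; auto.
      - assert (HW : 0 <= W x) by (unfold W; assert (H3 := exp_pos (m * (x - t0)));
          assert (H4 := exp_pos (- m * (x - t0))); lra).
        replace (M * (1 / 2) ^ S n) with (2 * C) by (unfold C; simpl; field).
        assert (0 <= C * W x) by now apply Rmult_le_pos.
        unfold m. nra. }
    (* The sign [sg] yields both halves of the absolute value. The difference of the two sides is
       convex with zero slope at [t0], where it is nonnegative. *)
    assert (Hmin : forall sg, sg = 1 \/ sg = -1 -> sg * picard_term (S n) t <= C * W t).
    { intros sg Hsg.
      assert (H := min_of_convex (fun x => C * W x - sg * picard_term (S n) x)
        (fun x => C * (m * exp (m * (x - t0)) - m * exp (- m * (x - t0)))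
                  - sg * picard_slope (S n) x)
        (fun x => C * m ^ 2 * W x - sg * picard_accel (S n) x) t0).
      cbv beta in H. rewrite Hz in H.
      assert (HW0 : 0 <= C * W t0).
      { apply Rmult_le_pos; [exact HC|]. unfold W.
        assert (H3 := exp_pos (m * (t0 - t0))); assert (H4 := exp_pos (- m * (t0 - t0))); lra. }
      enough (C * W t0 - sg * 0 <= C * W t - sg * picard_term (S n) t) by lra.
      apply H.
      - intros x. apply (is_derive_minus (fun x => C * W x)).
        + unfold W. auto_derive; [exact I|unfold Rminus; ring].
        + apply (is_derive_scal (picard_term (S n))). apply H1.
      - intros x. apply (is_derive_minus (fun x => C * (m * exp (m * (x - t0)) - m * exp (- m * (x - t0))))).
        + unfold W. auto_derive; [exact I|unfold Rminus; ring].
        + apply (is_derive_scal (picard_slope (S n))). apply H2.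
      - rewrite Hz1, Rminus_diag. repeat rewrite Rmult_0_r. ring.
      - intros x. specialize (Hacc x). apply Rabs_le_between in Hacc.
        destruct Hsg; subst sg; lra. }
    apply Rabs_le. split; [specialize (Hmin (-1))|specialize (Hmin 1)]; lra.
Qed.

(** On a ball, [W] is at most [2 exp(m r)]. The index shift in [picard_accel] costs a factor 2, and
    slopes of positive index vanish at [t0], so the mean value theorem bounds them by the
    accelerations. *)
Lemma picard_local_bound r : 0 < r ->
  exists C, forall n t, Rabs (t - t0) < r ->
    Rabs (picard_term n t) <= C * (1 / 2) ^ S n /\
    Rabs (picard_slope n t) <= C * (1 / 2) ^ S n /\
    Rabs (picard_accel n t) <= C * (1 / 2) ^ S n.
Proof.
  intros Hr.
  assert (HB := picard_B_pos).
  assert (Hm : 1 <= m) by (unfold m; lra).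
  assert (Hy0 := Rabs_pos y0). assert (Hv0 := Rabs_pos v0).
  set (E := 2 * exp (m * r)).
  assert (HE : 0 < E) by (assert (H := exp_pos (m * r)); unfold E; lra).
  assert (HW : forall t, Rabs (t - t0) < r -> W t <= E).
  { intros t Ht. apply Rabs_lt_between in Ht. unfold W, E.
    assert (exp (m * (t - t0)) <= exp (m * r)) by (apply exp_le; nra).
    assert (exp (- m * (t - t0)) <= exp (m * r)) by (apply exp_le; nra).
    lra. }
  assert (HM : 0 <= M) by (unfold M; lra).
  set (D := M * E).
  assert (HD : 0 <= D) by (apply Rmult_le_pos; lra).
  assert (Hpow : forall n, 0 < (1 / 2) ^ n) by (intros n; apply pow_lt; lra).
  assert (Hterm : forall n t, Rabs (t - t0) < r -> Rabs (picard_term n t) <= D * (1 / 2) ^ S n).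
  { intros n t Ht. eapply Rle_trans; [apply picard_term_bound|].
    unfold D. specialize (HW t Ht). specialize (Hpow (S n)).
    assert (0 <= M * (1 / 2) ^ S n) by (apply Rmult_le_pos; lra). nra. }
  assert (Hacc : forall n t, Rabs (t - t0) < r ->
    Rabs (picard_accel n t) <= 2 * B * D * (1 / 2) ^ S n).
  { intros [|n] t Ht; simpl picard_accel.
    - rewrite Rabs_R0. specialize (Hpow 1%nat). apply Rmult_le_pos; [nra|lra].
    - rewrite Rabs_mult, Rabs_Ropp.
      apply Rle_trans with (B * (D * (1 / 2) ^ S n)); [|simpl; right; field].
      apply Rmult_le_compat; try apply Rabs_pos; auto. }
  exists (D + 2 * B * D + 2 * B * D * r + 2 * Rabs v0).
  assert (HBD : 0 <= B * D) by now apply Rmult_le_pos.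
  assert (HBDr : 0 <= B * D * r) by (apply Rmult_le_pos; lra).
  intros n t Ht. split; [|split].
  - eapply Rle_trans; [apply Hterm, Ht|]. apply Rmult_le_compat_r; [left; apply Hpow|lra].
  - destruct n as [|n].
    + simpl picard_slope. simpl. lra.
    + destruct (picard_term_slope (S n)) as [_ H2].
      destruct (MVT_gen (picard_slope (S n)) t0 t (picard_accel (S n))) as [z [Hz Hs]].
      * intros x _. apply H2.
      * intros x _. apply ex_derive_continuity_pt. eexists. apply H2.
      * replace (picard_slope (S n) t0) with 0 in Hs by (simpl; now rewrite RInt_point).
        rewrite Rminus_0_r in Hs. rewrite Hs, Rabs_mult.
        assert (Hzr : Rabs (z - t0) < r).
        { apply Rabs_lt_between in Ht. apply Rabs_lt_between.
          revert Hz. unfold Rmin, Rmax. destruct Rle_dec; lra. }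
        specialize (Hacc (S n) z Hzr). assert (Hp := Hpow (S (S n))).
        apply Rle_trans with (2 * B * D * (1 / 2) ^ S (S n) * r).
        { apply Rmult_le_compat; try apply Rabs_pos; lra. }
        replace (2 * B * D * (1 / 2) ^ S (S n) * r) with (2 * B * D * r * (1 / 2) ^ S (S n)) by ring.
        apply Rmult_le_compat_r; lra.
  - eapply Rle_trans; [apply Hacc, Ht|]. apply Rmult_le_compat_r; [left; apply Hpow|lra].
Qed.

Lemma linear_ode_exists :
  exists y y1 : R -> R, y t0 = y0 /\ y1 t0 = v0 /\
    (forall t, is_derive y t (y1 t)) /\ (forall t, is_derive y1 t (- q t * y t)).
Proof.
  exists (fun t => Series (fun n => picard_term n t)), (fun t => Series (fun n => picard_slope n t)).
  split; [|split; [|split]].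
  - rewrite (Series_eq_single _ O); [simpl; ring|].
    intros [|n] Hn; [easy|]. simpl. now rewrite RInt_point.
  - rewrite (Series_eq_single _ O); [reflexivity|].
    intros [|n] Hn; [easy|]. simpl. now rewrite RInt_point.
  - apply (is_derive_Series_geom _ _ t0).
    + intros n. apply picard_term_slope.
    + intros r Hr. destruct (picard_local_bound r Hr) as [C HC].
      exists C. intros n t Ht. split; now apply HC.
  - intros t.
    (* The acceleration of index 0 is zero, so dropping it shifts the series into [- q] times the
       series of terms. *)
    replace (- q t * Series (fun n => picard_term n t)) with (Series (fun n => picard_accel n t)).
    + revert t. apply (is_derive_Series_geom _ _ t0).
      * intros n. apply picard_term_slope.
      * intros r Hr. destruct (picard_local_bound r Hr) as [C HC].
        exists C. intros n t Ht. split; now apply HC.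
    + rewrite <- Series_scal_l. now apply Series_incr_1_aux.
Qed.

End Picard.

(** * Parametric resonance *)

(** [1 - bump_profile eps x] equals [- y'' / y] for [y = sin x * exp(2 eps (x - sin x cos x))]. *)
Definition bump_profile (eps x : R) : R :=
  16 * eps * (sin x * cos x) + 16 * eps ^ 2 * sin x ^ 4.

(* Clamping [t] to [[a, b]] extends the oscillation by [0], since the profile
   vanishes at both ends as soon as [sin (m * (b - a)) = 0]. *)
Definition bump (l m a b eps t : R) : R :=
  - (m ^ 2 / l ^ 2) * bump_profile eps (m * (Rmax a (Rmin b t) - a)).

Lemma bump_profile_bound (eps x : R) :
  0 <= eps <= 1 -> Rabs (bump_profile eps x) <= 32 * eps.
Proof.
  intros He. unfold bump_profile.
  assert (H := sin2_cos2 x). unfold Rsqr in H.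
  assert (Hs2 : 0 <= sin x * sin x <= 1) by nra.
  assert (Hsc : -1 <= sin x * cos x <= 1) by (split; nra).
  assert (Hs4 : 0 <= sin x ^ 4 <= 1) by (simpl; split; nra).
  assert (Hee : 0 <= eps ^ 2 <= eps) by nra.
  apply Rabs_le. split; nra.
Qed.

Lemma bump_profile_lipschitz (eps x y : R) :
  0 <= eps <= 1 ->
  Rabs (bump_profile eps x - bump_profile eps y) <= 80 * eps * Rabs (x - y).
Proof.
  intros He.
  assert (Hd : forall z, is_derive (bump_profile eps) z
    (16 * eps * (cos z * cos z - sin z * sin z) + 64 * eps ^ 2 * (sin z ^ 3 * cos z))).
  { intros z. unfold bump_profile. auto_derive; [exact I|]. simpl; ring. }
  destruct (MVT_gen (bump_profile eps) y x
    (fun z => 16 * eps * (cos z * cos z - sin z * sin z) + 64 * eps ^ 2 * (sin z ^ 3 * cos z)))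
    as [z [_ Hz]].
  - intros z _. apply Hd.
  - intros z _. apply ex_derive_continuity_pt. eexists. apply Hd.
  - rewrite Hz, Rabs_mult. apply Rmult_le_compat_r; [apply Rabs_pos|].
    assert (H := sin2_cos2 z). unfold Rsqr in H.
    assert (Hs2 : 0 <= sin z * sin z <= 1) by nra.
    assert (Hsc : -1 <= sin z * cos z <= 1) by (split; nra).
    assert (Hs3 : -1 <= sin z ^ 3 * cos z <= 1).
    { replace (sin z ^ 3 * cos z) with ((sin z * sin z) * (sin z * cos z)) by ring.
      split; nra. }
    assert (Hc : -1 <= cos z * cos z - sin z * sin z <= 1) by nra.
    assert (Hee : 0 <= eps ^ 2 <= eps) by nra.
    apply Rabs_le. split; nra.
Qed.

Section Bump.

Variables (l m a b eps : R).
Hypothesis (m_pos : 0 < m) (m_le_l : m <= l) (a_le_b : a <= b) (eps_range : 0 <= eps <= 1).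
Hypothesis sin_end : sin (m * (b - a)) = 0.

Lemma bump_factor : 0 <= m ^ 2 / l ^ 2 <= 1.
Proof.
  split.
  - apply Rmult_le_pos; [apply pow2_ge_0|]. left. apply Rinv_0_lt_compat. nra.
  - apply (Rmult_le_reg_r (l ^ 2)); [nra|].
    unfold Rdiv. rewrite Rmult_assoc, Rinv_l by nra. nra.
Qed.

Lemma bump_inside t : a <= t <= b ->
  bump l m a b eps t = - (m ^ 2 / l ^ 2) * bump_profile eps (m * (t - a)).
Proof.
  intros Ht. unfold bump. rewrite Rmin_right, Rmax_right by lra. reflexivity.
Qed.

Lemma bump_before t : t <= a -> bump l m a b eps t = 0.
Proof.
  intros Ht. unfold bump. rewrite Rmin_right, Rmax_left by lra.
  unfold bump_profile. rewrite Rminus_diag, Rmult_0_r, sin_0. ring.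
Qed.

Lemma bump_after t : b <= t -> bump l m a b eps t = 0.
Proof.
  intros Ht. unfold bump. rewrite Rmin_left, Rmax_right by lra.
  unfold bump_profile. rewrite sin_end. ring.
Qed.

Lemma bump_bound t : Rabs (bump l m a b eps t) <= 32 * eps.
Proof.
  unfold bump. rewrite Rabs_mult, Rabs_Ropp.
  destruct bump_factor as [H0 H1]. rewrite (Rabs_right (m ^ 2 / l ^ 2)) by lra.
  assert (H := bump_profile_bound eps (m * (Rmax a (Rmin b t) - a)) eps_range).
  assert (H2 := Rabs_pos (bump_profile eps (m * (Rmax a (Rmin b t) - a)))).
  nra.
Qed.

Lemma bump_lipschitz t s :
  Rabs (bump l m a b eps t - bump l m a b eps s) <= 80 * eps * l * Rabs (t - s).
Proof.
  unfold bump. rewrite <- Rmult_minus_distr_l, Rabs_mult, Rabs_Ropp.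
  destruct bump_factor as [H0 H1]. rewrite (Rabs_right (m ^ 2 / l ^ 2)) by lra.
  set (x := Rmax a (Rmin b t)). set (y := Rmax a (Rmin b s)).
  assert (Hxy : Rabs (x - y) <= Rabs (t - s)).
  { unfold x, y, Rmax, Rmin.
    repeat destruct Rle_dec; unfold Rabs; repeat destruct Rcase_abs; lra. }
  assert (H := bump_profile_lipschitz eps (m * (x - a)) (m * (y - a)) eps_range).
  replace (m * (x - a) - m * (y - a)) with (m * (x - y)) in H by ring.
  rewrite Rabs_mult, (Rabs_right m) in H by lra.
  set (D := Rabs (bump_profile eps (m * (x - a)) - bump_profile eps (m * (y - a)))) in *.
  assert (HD : 0 <= D) by apply Rabs_pos.
  apply Rle_trans with D; [nra|].
  apply Rle_trans with (80 * eps * (m * Rabs (x - y))); [exact H|].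
  rewrite (Rmult_assoc (80 * eps)). apply Rmult_le_compat_l; [lra|].
  apply Rmult_le_compat; try lra. apply Rabs_pos.
Qed.

(** The scale [1 / l] separates two cases. For distant points the sup bound suffices and [omega] is
    monotone. For close points the Lipschitz bound applies, and monotonicity of [x / omega x] gives
    [l |t - s| omega(1 / l) <= omega(|t - s|)]. *)
Lemma bump_modulus (omega : R -> R) (t s : R) :
  continuity_modulus omega ->
  omega (1 / l) * Rabs (bump l m a b eps t - bump l m a b eps s)
  <= 80 * eps * omega (Rabs (t - s)).
Proof.
  intros Hom. set (D := Rabs (bump l m a b eps t - bump l m a b eps s)).
  assert (Hl : 0 < l) by lra.
  assert (Hil : 0 < 1 / l) by (apply Rdiv_lt_0_compat; lra).
  assert (HD : 0 <= D) by apply Rabs_pos.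
  assert (Hw := cm_pos _ Hom _ Hil).
  destruct (Rle_dec (1 / l) (Rabs (t - s))) as [Hfar|Hnear].
  - assert (Hw2 := cm_nondecr _ Hom (1 / l) (Rabs (t - s)) ltac:(lra) Hfar).
    assert (HD2 : D <= 64 * eps).
    { unfold D. eapply Rle_trans; [apply Rabs_triang|]. rewrite Rabs_Ropp.
      assert (H1 := bump_bound t). assert (H2 := bump_bound s). lra. }
    apply Rle_trans with (omega (1 / l) * (80 * eps)); [nra|].
    rewrite Rmult_comm. apply Rmult_le_compat_l; lra.
  - destruct (Req_dec t s) as [->|Hne].
    + assert (E : D = 0) by (unfold D; now rewrite Rminus_diag, Rabs_R0).
      rewrite E, Rminus_diag, Rabs_R0, (cm_zero _ Hom). lra.
    + assert (Hts : 0 < Rabs (t - s)) by (apply Rabs_pos_lt; lra).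
      assert (Hw2 := cm_pos _ Hom _ Hts).
      assert (Hr := cm_ratio_nondecr _ Hom (Rabs (t - s)) (1 / l) Hts ltac:(lra)).
      assert (HD2 : D <= 80 * eps * l * Rabs (t - s)) by apply bump_lipschitz.
      assert (Hr2 : l * Rabs (t - s) * omega (1 / l) <= omega (Rabs (t - s))).
      { apply (Rmult_le_compat_r (l * omega (1 / l) * omega (Rabs (t - s)))) in Hr.
        - replace (Rabs (t - s) / omega (Rabs (t - s)) * (l * omega (1 / l) * omega (Rabs (t - s))))
            with (l * Rabs (t - s) * omega (1 / l)) in Hr by (field; lra).
          replace (1 / l / omega (1 / l) * (l * omega (1 / l) * omega (Rabs (t - s))))
            with (omega (Rabs (t - s))) in Hr by (field; lra).
          exact Hr.
        - repeat apply Rmult_le_pos; lra. }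
      apply Rle_trans with (omega (1 / l) * (80 * eps * l * Rabs (t - s))).
      { apply Rmult_le_compat_l; lra. }
      replace (omega (1 / l) * (80 * eps * l * Rabs (t - s)))
        with (80 * eps * (l * Rabs (t - s) * omega (1 / l))) by ring.
      apply Rmult_le_compat_l; lra.
Qed.

End Bump.

(* The exponent has derivative [4 eps m sin(m (t - a))^2 >= 0]; computing
   [- y'' / y] for this [y] is how [bump_profile] is found. *)
Definition resonant (A m a eps t : R) : R :=
  A * sin (m * (t - a))
  * exp (2 * eps * (m * (t - a) - sin (m * (t - a)) * cos (m * (t - a)))).

Definition resonant_slope (A m a eps t : R) : R :=
  A * m * (cos (m * (t - a)) + 4 * eps * sin (m * (t - a)) ^ 3)
  * exp (2 * eps * (m * (t - a) - sin (m * (t - a)) * cos (m * (t - a)))).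

Lemma is_derive_resonant (A m a eps t : R) :
  is_derive (resonant A m a eps) t (resonant_slope A m a eps t).
Proof.
  unfold resonant, resonant_slope. auto_derive; [exact I|].
  fold (t - a). set (x := m * (t - a)).
  set (E := exp _).
  assert (H : cos x * cos x = 1 - sin x * sin x)
    by (assert (H := sin2_cos2 x); unfold Rsqr in H; lra).
  ring_simplify. replace (cos x ^ 2) with (1 - sin x * sin x) by (rewrite <- H; ring). ring.
Qed.

Lemma is_derive_resonant_slope (A m a eps t : R) :
  is_derive (resonant_slope A m a eps) t
    (- (m ^ 2 * (1 - bump_profile eps (m * (t - a)))) * resonant A m a eps t).
Proof.
  unfold resonant, resonant_slope, bump_profile. auto_derive; [exact I|].
  fold (t - a). set (x := m * (t - a)).
  set (E := exp _).
  assert (H : cos x * cos x = 1 - sin x * sin x)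
    by (assert (H := sin2_cos2 x); unfold Rsqr in H; lra).
  assert (H3 : cos x ^ 3 = cos x * (1 - sin x * sin x)) by (rewrite <- H; ring).
  assert (H2 : cos x ^ 2 = 1 - sin x * sin x) by (rewrite <- H; ring).
  ring_simplify. rewrite ?H3, ?H2. ring.
Qed.

(** * Choice of the frequencies *)

Lemma strictly_increasing_lt (n : nat -> nat) :
  (forall k, (n k < n (S k))%nat) -> forall i j, (i < j)%nat -> (n i < n j)%nat.
Proof.
  intros Hn i j Hij. induction Hij as [|j Hij IH]; [apply Hn|].
  specialize (Hn j). lia.
Qed.

(** Partial sums are constant between consecutive indices [n k], and from [n k0] on they grow at
    most like a geometric series; being monotone and bounded, they converge. *)
Lemma ex_series_sparse (a : nat -> R) (n : nat -> nat) (C : R) (k0 : nat) :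
  (forall j, 0 <= a j) -> (forall k, (n k < n (S k))%nat) ->
  (forall j, (forall k, j <> n k) -> a j = 0) ->
  (forall k, (k0 <= k)%nat -> a (n k) <= C * (1 / 2) ^ k) ->
  ex_series a.
Proof.
  intros Ha Hn Hzero HC.
  assert (Hlt := strictly_increasing_lt n Hn).
  assert (Hgap : forall k i, (n k + i < n (S k))%nat -> sum_n a (n k + i) = sum_n a (n k)).
  { intros k i. induction i as [|i IH]; intros Hi; [now rewrite Nat.add_0_r|].
    rewrite Nat.add_succ_r, sum_Sn, IH by lia.
    rewrite Hzero; [apply Rplus_0_r|].
    intros j Hj.
    destruct (Nat.lt_trichotomy j k) as [H|[->|H]].
    - specialize (Hlt j k H). lia.
    - lia.
    - destruct (Nat.eq_dec j (S k)) as [->|Hne]; [lia|].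
      specialize (Hlt (S k) j ltac:(lia)). lia. }
  assert (HC0 : 0 <= C).
  { specialize (HC k0 (le_n _)). specialize (Ha (n k0)).
    assert (0 < (1 / 2) ^ k0) by (apply pow_lt; lra). nra. }
  assert (Hincr : forall j, sum_n a j <= sum_n a (S j)).
  { intros j. rewrite sum_Sn. specialize (Ha (S j)). unfold plus; simpl. lra. }
  assert (Hmono : forall i j, (i <= j)%nat -> sum_n a i <= sum_n a j).
  { intros i j Hij. induction Hij as [|j Hij IH]; [lra|].
    eapply Rle_trans; [exact IH|apply Hincr]. }
  assert (Hbound : forall i,
    sum_n a (n (k0 + i)%nat) <= sum_n a (n k0) + 2 * C * (1 - (1 / 2) ^ i)).
  { intros i. induction i as [|i IH]; [rewrite Nat.add_0_r; simpl; lra|].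
    rewrite Nat.add_succ_r. set (k := (k0 + i)%nat) in *.
    assert (Hs : sum_n a (n (S k)) = sum_n a (n k) + a (n (S k))).
    { assert (Hk := Hn k). destruct (n (S k)) as [|N] eqn:E; [lia|].
      rewrite sum_Sn. unfold plus; simpl. f_equal.
      replace N with (n k + (N - n k))%nat by lia. apply Hgap. lia. }
    rewrite Hs. specialize (HC (S k) ltac:(lia)).
    assert (Hp : (1 / 2) ^ S k <= (1 / 2) ^ S i).
    { assert (E : (1 / 2) ^ S k = (1 / 2) ^ S i * (1 / 2) ^ k0)
        by (rewrite <- pow_add; f_equal; lia).
      assert (0 < (1 / 2) ^ S i) by (apply pow_lt; lra).
      assert ((1 / 2) ^ k0 <= 1) by (apply Rle_trans with (1 ^ k0); [apply pow_incr; lra|rewrite pow1; lra]).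
      rewrite E. apply Rle_trans with ((1 / 2) ^ S i * 1); [|lra].
      apply Rmult_le_compat_l; lra. }
    assert (C * (1 / 2) ^ S k <= C * (1 / 2) ^ S i) by now apply Rmult_le_compat_l.
    assert (E : (1 / 2) ^ S i = 1 / 2 * (1 / 2) ^ i) by reflexivity.
    assert (0 <= C * (1 / 2) ^ i) by (apply Rmult_le_pos; [lra|apply pow_le; lra]).
    rewrite E in *. lra. }
  assert (Hge : forall i, (i <= n i)%nat).
  { intros i. induction i as [|i IH]; [lia|]. specialize (Hn i). lia. }
  destruct (ex_finite_lim_seq_incr (sum_n a) (sum_n a (n k0) + 2 * C) Hincr) as [s Hs];
    [|now exists s].
  intros i. apply Rle_trans with (sum_n a (n (k0 + i)%nat)).
  - apply Hmono. specialize (Hge (k0 + i)%nat). lia.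
  - eapply Rle_trans; [apply Hbound|].
    assert (0 < (1 / 2) ^ i) by (apply pow_lt; lra). nra.
Qed.

(** As [lambda] is only assumed unbounded, the induction also asks for a value above [lambda n0],
    which excludes the index [n0] itself. *)
Lemma unbounded_seq_tail (lambda : nat -> R) (M : R) (n0 : nat) :
  unbounded_seq lambda -> exists n, (n0 <= n)%nat /\ M < lambda n.
Proof.
  intros Hunb. revert M. induction n0 as [|n0 IH]; intros M.
  - destruct (Hunb M) as [n Hn]. exists n. split; [lia|exact Hn].
  - destruct (IH (Rmax M (lambda n0))) as [n [Hn HM]].
    assert (H1 := Rmax_l M (lambda n0)). assert (H2 := Rmax_r M (lambda n0)).
    exists n. split; [|lra].
    destruct (Nat.eq_dec n n0) as [->|Hne]; [lra|lia].
Qed.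

(** The default 1 for the first mode, which has no predecessor, keeps this usable as a Lipschitz
    constant and as a factor at least 1. *)
Definition previous_value (lambda : nat -> R) (n : nat -> nat) (k : nat) : R :=
  match k with O => 1 | S i => lambda (n i) end.

(** Dependent choice: each frequency only has to pass a threshold determined by its rank and its
    predecessor. *)
Lemma subsequence_selection (P : nat -> R -> R -> Prop) (lambda : nat -> R) :
  unbounded_seq lambda ->
  (forall k p, exists X, forall x, X < x -> P k p x) ->
  exists n : nat -> nat, (forall k, (n k < n (S k))%nat) /\
    forall k, P k (previous_value lambda n k) (lambda (n k)).
Proof.
  intros Hunb HP.
  assert (Hnext : forall kj : nat * nat, exists j,
    (snd kj < j)%nat /\ P (S (fst kj)) (lambda (snd kj)) (lambda j)).
  { intros [k i]. destruct (HP (S k) (lambda i)) as [X HX].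
    destruct (unbounded_seq_tail lambda X (S i) Hunb) as [j [Hj HXj]].
    exists j. split; [simpl; lia|now apply HX]. }
  destruct (functional_choice _ Hnext) as [f Hf].
  destruct (HP O 1) as [X HX]. destruct (Hunb X) as [j0 Hj0].
  set (n := fix n k := match k with O => j0 | S i => f (i, n i) end).
  exists n. split.
  - intros k. apply (Hf (k, n k)).
  - intros [|k]; [now apply HX|]. apply (Hf (k, n k)).
Qed.

(** * Consequences of the limits of [omega] for high frequencies *)

Lemma modulus_small (omega : R -> R) (eta : R) :
  continuity_modulus omega -> 0 < eta ->
  exists d, 0 < d /\ forall x, 0 <= x < d -> omega x < eta.
Proof.
  intros Hom Heta.
  destruct (cm_continuous _ Hom 0 (Rle_refl 0) (fun y => Rabs (y - omega 0) < eta)) as [d Hd].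
  { exists (mkposreal eta Heta). intros y Hy. exact Hy. }
  exists d. split; [apply cond_pos|].
  intros x [Hx Hxd]. specialize (Hd x).
  assert (H : Rabs (omega x - omega 0) < eta).
  { apply Hd; [|exact Hx]. change (Rabs (x - 0) < d). rewrite Rminus_0_r, Rabs_right; lra. }
  rewrite (cm_zero _ Hom), Rminus_0_r in H. apply Rabs_lt_between in H. lra.
Qed.

Lemma modulus_dominates (omega f : R -> R) (M : R) :
  (forall x, 0 < x -> 0 < f x) ->
  is_lim (fun x => x / f x * omega (1 / x)) p_infty p_infty ->
  exists X, 0 < X /\ forall x, X < x -> M * f x <= x * omega (1 / x).
Proof.
  intros Hf Hlim. apply is_lim_spec in Hlim. destruct (Hlim M) as [X HX].
  exists (Rmax X 1). split; [assert (H := Rmax_r X 1); lra|].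
  intros x Hx.
  assert (H1 := Rmax_l X 1). assert (H2 := Rmax_r X 1).
  specialize (HX x ltac:(lra)). specialize (Hf x ltac:(lra)).
  replace (x * omega (1 / x)) with (x / f x * omega (1 / x) * f x) by (field; lra).
  apply Rmult_le_compat_r; lra.
Qed.

(** Substituting [eps = 1 / x] turns [eps ^ (1 - s) * x] into [x ^ s]. It is applied with
    [s = 2 sigma], the order of the damping. *)
Lemma modulus_dominates_power (omega : R -> R) (s M : R) :
  filterlim (fun eps => omega eps / Rpower eps (1 - s)) (at_right 0) (Rbar_locally p_infty) ->
  exists X, 0 < X /\ forall x, X < x -> M * Rpower x s <= x * omega (1 / x).
Proof.
  intros Hlim.
  destruct (Hlim (fun y => M < y)) as [d Hd]; [now exists M|].
  assert (Hd0 := cond_pos d).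
  assert (Hid : 0 < / d) by now apply Rinv_0_lt_compat.
  exists (/ d). split; [exact Hid|].
  intros x Hx.
  assert (Hix : 0 < 1 / x) by (apply Rdiv_lt_0_compat; lra).
  assert (Hlt : 1 / x < d).
  { unfold Rdiv. rewrite Rmult_1_l, <- (Rinv_inv d). apply Rinv_lt_contravar; [nra|exact Hx]. }
  specialize (Hd (1 / x)).
  assert (H : M < omega (1 / x) / Rpower (1 / x) (1 - s)).
  { apply Hd; [|exact Hix]. change (Rabs (1 / x - 0) < d). rewrite Rminus_0_r, Rabs_right; lra. }
  assert (E : Rpower (1 / x) (1 - s) * x = Rpower x s).
  { unfold Rdiv at 1. rewrite Rmult_1_l. unfold Rpower at 1. rewrite ln_Rinv by lra.
    rewrite <- (exp_ln x) at 2 by lra. rewrite <- exp_plus. unfold Rpower. f_equal. ring. }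
  assert (Hp : 0 < Rpower (1 / x) (1 - s)) by apply exp_pos.
  rewrite <- E.
  replace (x * omega (1 / x))
    with (omega (1 / x) / Rpower (1 / x) (1 - s) * (Rpower (1 / x) (1 - s) * x))
    by (field; lra).
  apply Rmult_le_compat_r; [|lra]. apply Rmult_le_pos; lra.
Qed.

(** [rf_large] provides many oscillations and dominates the earlier frequencies, [rf_small] keeps
    the bump small for the earlier modes, and the last three let the growth exponent beat the
    damping and both weights. *)
Record resonant_frequency (s : R) (omega phi psi : R -> R) (M x : R) : Prop := {
  rf_large : M <= x;
  rf_small : M * omega (1 / x) <= 1;
  rf_power : M * Rpower x s <= x * omega (1 / x);
  rf_phi : M * phi x <= x * omega (1 / x);
  rf_psi : M * psi x <= x * omega (1 / x)
}.

Lemma resonant_frequency_eventually (s : R) (omega phi psi : R -> R) (M : R) :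
  continuity_modulus omega ->
  filterlim (fun eps => omega eps / Rpower eps (1 - s)) (at_right 0) (Rbar_locally p_infty) ->
  (forall x, 0 < x -> 0 < phi x) -> (forall x, 0 < x -> 0 < psi x) ->
  is_lim (fun x => x / phi x * omega (1 / x)) p_infty p_infty ->
  is_lim (fun x => x / psi x * omega (1 / x)) p_infty p_infty ->
  0 < M ->
  exists X, forall x, X < x -> resonant_frequency s omega phi psi M x.
Proof.
  intros Hom Hs Hphi Hpsi Hphil Hpsil HM.
  destruct (modulus_dominates_power omega s M Hs) as [X1 [HX1 H1]].
  destruct (modulus_dominates omega phi M Hphi Hphil) as [X2 [HX2 H2]].
  destruct (modulus_dominates omega psi M Hpsi Hpsil) as [X3 [HX3 H3]].
  assert (HiM : 0 < / M) by now apply Rinv_0_lt_compat.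
  destruct (modulus_small omega (/ M) Hom HiM) as [d [Hd Hsmall]].
  assert (Hid : 0 < / d) by now apply Rinv_0_lt_compat.
  exists (M + X1 + X2 + X3 + / d). intros x Hx.
  split; [lra| |apply H1; lra|apply H2; lra|apply H3; lra].
  assert (Hix : 0 < 1 / x) by (apply Rdiv_lt_0_compat; lra).
  assert (Hlt : 1 / x < d).
  { unfold Rdiv. rewrite Rmult_1_l, <- (Rinv_inv d). apply Rinv_lt_contravar; [nra|lra]. }
  specialize (Hsmall (1 / x) ltac:(lra)).
  apply (Rmult_le_reg_l (/ M)); [exact HiM|].
  rewrite <- Rmult_assoc, Rinv_l by lra. lra.
Qed.

(** * One resonant mode *)

(** The end point [b] is the last time in the dyadic interval at which a whole number of half
    periods is complete. Here [w] stands for [omega (1 / l)] and [s] for a sum of four quantities to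
    be dominated, whence the factor 4. *)
Lemma resonance_parameters (k : nat) (p l d w s : R) :
  1 <= p -> 2560 * 8 ^ k * p <= l -> 0 <= d <= l / 2 -> 0 < w ->
  2560 * 8 ^ k * p * w <= 1 -> 2560 * 8 ^ k * p * s <= 4 * (l * w) ->
  exists m b,
    l / 2 <= m <= l /\ m ^ 2 = l ^ 2 - d ^ 2 /\
    (1 / 2) ^ S k <= b <= (1 / 2) ^ k /\ sin (m * (b - (1 / 2) ^ S k)) = 0 /\
    2 ^ k * p * s <= 2 * ((1 / 2) ^ S k * w / 80) * m * (b - (1 / 2) ^ S k).
Proof.
  intros Hp Hl Hd Hw Hpw Hps.
  set (h := (1 / 2) ^ k). change ((1 / 2) ^ S k) with (1 / 2 * h).
  assert (H2 : 1 <= 2 ^ k) by (apply pow_R1_Rle; lra).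
  assert (Hh : 2 ^ k * h = 1).
  { unfold h. rewrite <- Rpow_mult_distr.
    replace (2 * (1 / 2)) with 1 by field. apply pow1. }
  assert (H8 : 8 ^ k = 2 ^ k * 2 ^ k * 2 ^ k).
  { rewrite <- !Rpow_mult_distr. f_equal. lra. }
  rewrite H8 in Hl, Hpw, Hps. clear H8.
  set (e := 2 ^ k) in *.
  assert (Hh0 : 0 < h) by nra.
  assert (He2 : 1 <= e * e) by nra.
  assert (He3 : e <= e * e * e) by nra.
  assert (Hel : 2560 * e <= l).
  { eapply Rle_trans; [|exact Hl]. nra. }
  set (m := sqrt (l ^ 2 - d ^ 2)).
  assert (Hm2 : m ^ 2 = l ^ 2 - d ^ 2) by (apply pow2_sqrt; nra).
  assert (Hm0 : 0 <= m) by apply sqrt_pos.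
  assert (Hm : l / 2 <= m <= l) by (split; nra).
  assert (HPI := PI_RGT_0). assert (HPI4 := PI_4).
  destruct (nfloor_ex (m * (1 / 2 * h) / PI)) as [N HN].
  { apply Rmult_le_pos; [nra|]. left. now apply Rinv_0_lt_compat. }
  assert (HNpi : INR N * PI <= m * (1 / 2 * h) < INR N * PI + PI).
  { assert (E : m * (1 / 2 * h) / PI * PI = m * (1 / 2 * h)) by (field; lra).
    rewrite <- E. split; nra. }
  (* Rounding down loses less than [PI <= 4], while [m * h >= 16]; so at least half of the interval,
     of length [h / 2], is kept. *)
  assert (Hb : m * (INR N * PI / m) = INR N * PI) by (field; lra).
  assert (HL : h / 4 <= INR N * PI / m <= 1 / 2 * h).
  { set (L := INR N * PI / m) in *.
    assert (Hmh : 16 <= m * h) by nra.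
    split; apply (Rmult_le_reg_l m); nra. }
  exists m, (1 / 2 * h + INR N * PI / m).
  replace (1 / 2 * h + INR N * PI / m - 1 / 2 * h) with (INR N * PI / m) by ring.
  split; [exact Hm|split; [exact Hm2|split; [lra|split]]].
  - rewrite Hb, INR_IZR_INZ. apply sin_eq_0_1. now exists (Z.of_nat N).
  - set (L := INR N * PI / m) in *.
    (* The left side is [h ^ 2 * (4 l w) / 2560]. Of the three factors [2 ^ k] in [8 ^ k], two
       compensate [h ^ 2] and the third remains as gain. *)
    assert (Hlow : 2 * (1 / 2 * h * w / 80) * (l / 2) * (h / 4)
      <= 2 * (1 / 2 * h * w / 80) * m * L).
    { rewrite 2!(Rmult_assoc (2 * _)). apply Rmult_le_compat_l; [nra|].
      apply Rmult_le_compat; lra. }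
    eapply Rle_trans; [|exact Hlow].
    replace (2 * (1 / 2 * h * w / 80) * (l / 2) * (h / 4)) with (h * h * (4 * (l * w)) / 2560) by field.
    apply Rle_trans with (h * h * (2560 * (e * e * e) * p * s) / 2560).
    + right. replace (h * h * (2560 * (e * e * e) * p * s) / 2560)
        with ((e * h) * (e * h) * (e * p * s)) by field.
      rewrite Hh. ring.
    + apply Rmult_le_compat_r; [lra|]. apply Rmult_le_compat_l; [nra|exact Hps].
Qed.

(* With [u = exp(- d t) y] the equation becomes
   [y'' + (m ^ 2 + l ^ 2 (c - 1)) y = 0], where [m ^ 2 = l ^ 2 - d ^ 2]; resonating
   at frequency [m] instead of [l] lets [c] return exactly to [1] outside the
   bumps.  Cauchy data are imposed at [b] because [energy_backward] propagates
   uniqueness to the left. *)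
Lemma resonant_mode_exists (l d m a b eps p : R) (c : R -> R) :
  1 <= l -> 0 <= d <= l / 2 -> l / 2 <= m -> m ^ 2 = l ^ 2 - d ^ 2 ->
  0 <= a <= 1 / 2 -> a <= b -> sin (m * (b - a)) = 0 -> 0 <= p ->
  (forall t, continuity_pt c t) ->
  (forall t, Rabs (c t - 1) <= 1 / 4) ->
  (forall t, 0 <= t <= a -> Rabs (c t - 1) <= 1 / l) ->
  (forall t, a <= t <= b -> c t - 1 = bump l m a b eps t) ->
  (forall t s, b <= t -> b <= s -> Rabs (c t - c s) <= p * Rabs (t - s)) ->
  let X := 2 * eps * m * (b - a) in
  exists u u1 : R -> R,
    (forall t, is_derive u t (u1 t)) /\
    (forall t, is_derive u1 t (- 2 * d * u1 t - l ^ 2 * c t * u t)) /\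
    (1 + l) ^ 2 * u 0 ^ 2 <= 16 * exp (- X) /\ u1 0 ^ 2 <= 16 * exp (- X) /\
    (forall t, b <= t ->
       exp (X - (2 * p + 2 * d) * t) <= 3 * ((1 + l) ^ 2 * u t ^ 2 + u1 t ^ 2)).
Proof.
  intros Hl Hd Hm Hm2 Ha Hab Hsin Hp Hc Hc4 Hca Hcab Hcb X.
  (* Normalization for which the energy [w1 ^ 2 + m ^ 2 w ^ 2] is [exp (- X)] at [a] and [exp X] at
     [b]. *)
  set (A := exp (- X / 2) / m).
  set (w := resonant A m a eps). set (w1 := resonant_slope A m a eps).
  assert (HX : exp (- X / 2) ^ 2 = exp (- X)).
  { simpl. rewrite Rmult_1_r, <- exp_plus. f_equal. lra. }
  assert (Hwa : w a = 0).
  { unfold w, resonant. rewrite Rminus_diag, Rmult_0_r, sin_0. ring. }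
  assert (Hw1a : w1 a ^ 2 = exp (- X)).
  { unfold w1, resonant_slope, A. rewrite Rminus_diag, Rmult_0_r, sin_0, cos_0.
    replace (2 * eps * (0 - 0 * 1)) with 0 by ring. rewrite exp_0.
    rewrite <- HX. field. lra. }
  assert (Hwb : w b = 0) by (unfold w, resonant; rewrite Hsin; ring).
  assert (Hw1b : w1 b ^ 2 = exp X).
  { unfold w1, resonant_slope, A. rewrite Hsin.
    replace (2 * eps * (m * (b - a) - 0 * cos (m * (b - a)))) with X by (unfold X; ring).
    assert (Hcos : cos (m * (b - a)) ^ 2 = 1).
    { assert (H := sin2_cos2 (m * (b - a))). rewrite Hsin in H. unfold Rsqr in H. lra. }
    replace ((exp (- X / 2) / m * m * (cos (m * (b - a)) + 4 * eps * 0 ^ 3) * exp X) ^ 2)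
      with (exp (- X / 2) ^ 2 * cos (m * (b - a)) ^ 2 * (exp X * exp X)) by (field; lra).
    rewrite HX, Hcos, Rmult_1_r, <- exp_plus, <- exp_plus. f_equal. ring. }
  destruct (linear_ode_exists (fun t => m ^ 2 + l ^ 2 * (c t - 1)) (m ^ 2 + l ^ 2 * (1 / 4)) b
              (w b) (w1 b)) as [y [y1 [Hyb [Hy1b [Hy Hy1]]]]].
  { intros t. apply continuity_pt_plus; [now apply continuity_pt_const|].
    apply continuity_pt_mult; [now apply continuity_pt_const|].
    apply continuity_pt_minus; [apply Hc|now apply continuity_pt_const]. }
  { intros t. eapply Rle_trans; [apply Rabs_triang|].
    rewrite Rabs_mult, (Rabs_right (m ^ 2)), (Rabs_right (l ^ 2)) by nra.
    apply Rplus_le_compat_l, Rmult_le_compat_l; [nra|apply Hc4]. }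
  assert (HQ : 3 / 4 * l ^ 2 <= m ^ 2) by nra.
  (* The energy of [y - w] vanishes at [b], hence at [a]. *)
  assert (Hya : y a = 0 /\ y1 a ^ 2 = exp (- X)).
  { assert (H := energy_backward (m ^ 2) l 0 (1 / 4) a b (fun _ => 0) (fun t => c t - 1)
      (fun t => y t - w t) (fun t => y1 t - w1 t) Hab ltac:(lra) ltac:(lra) ltac:(lra) HQ).
    cbv beta in H. rewrite Hyb, Hy1b in H.
    assert (Hz : (y1 a - w1 a) ^ 2 + (m ^ 2 + l ^ 2 * 0) * (y a - w a) ^ 2 <= 0).
    { eapply Rle_trans; [apply H|right; ring].
      - intros t _. rewrite Rabs_R0. lra.
      - intros t s _ _. rewrite Rminus_diag, Rabs_R0. lra.
      - intros t _. apply Hc4.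
      - intros t _. apply (is_derive_minus y w); [apply Hy|apply is_derive_resonant].
      (* The factor [m ^ 2 / l ^ 2] in [bump] turns [l ^ 2 (c - 1)] into [- m ^ 2 bump_profile], so
         [y] and [w] solve the same equation on [[a, b]]. *)
      - intros t Ht. rewrite Hcab by exact Ht.
        replace (- (m ^ 2 + l ^ 2 * (0 + bump l m a b eps t)) * (y t - w t))
          with (- (m ^ 2 + l ^ 2 * (c t - 1)) * y t
                - - (m ^ 2 * (1 - bump_profile eps (m * (t - a)))) * w t).
        + apply (is_derive_minus y1 w1); [apply Hy1|apply is_derive_resonant_slope].
        + rewrite Hcab, bump_inside by assumption. field. lra. }
    assert (Hz1 : 0 <= (y1 a - w1 a) ^ 2) by apply pow2_ge_0.
    assert (Hz2 : 0 <= (y a - w a) ^ 2) by apply pow2_ge_0.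
    assert (Hm0 : 0 < m ^ 2) by nra.
    assert (Hmz : 0 <= m ^ 2 * (y a - w a) ^ 2) by (apply Rmult_le_pos; lra).
    assert (Hy1a : (y1 a - w1 a) ^ 2 = 0) by lra.
    assert (Hya : (y a - w a) ^ 2 = 0).
    { destruct (Rmult_integral (m ^ 2) ((y a - w a) ^ 2)); lra. }
    assert (Hsq : forall x, x ^ 2 = 0 -> x = 0)
      by (intros x Hx; apply Rsqr_0_uniq; unfold Rsqr; lra).
    apply Hsq in Hya. apply Hsq in Hy1a.
    split; [|rewrite <- Hw1a; f_equal]; lra. }
  destruct Hya as [Hya Hy1a].
  (* Before resonance [c - 1] plays the role of the small [h2]: with [kappa = 1 / l] the exponent is
     [2 a <= 1], and [exp 1 <= 3]. *)
  assert (Hstart : y1 0 ^ 2 + m ^ 2 * y 0 ^ 2 <= 3 * exp (- X)).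
  { assert (H := energy_backward (m ^ 2) l 0 (1 / l) 0 a (fun _ => 0) (fun t => c t - 1)
      y y1 ltac:(lra) ltac:(lra) ltac:(lra)).
    cbv beta in H. rewrite Hya, Hy1a in H.
    replace (2 * (l * (1 / l) + 0) * (a - 0)) with (2 * a) in H by (field; lra).
    rewrite Rmult_0_r, Rplus_0_r in H.
    apply Rle_trans with (exp (2 * a) * (exp (- X) + m ^ 2 * 0 ^ 2)).
    - apply H; try assumption.
      + left. apply Rdiv_lt_0_compat; lra.
      + intros t _. rewrite Rabs_R0. lra.
      + intros t s _ _. rewrite Rminus_diag, Rabs_R0. lra.
      + intros t _. apply Hy.
      + intros t _. rewrite Rplus_0_l. apply Hy1.
    - assert (He : exp (2 * a) <= 3).
      { apply Rle_trans with (exp 1); [apply exp_le; lra|apply exp_le_3]. }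
      assert (Hp0 := exp_pos (- X)). nra. }
  (* After resonance the roles are exchanged: [c - 1] is the Lipschitz part [h1], with constant [p],
     and [h2] is zero. *)
  assert (Hend : forall t, b <= t -> exp (X - 2 * p * t) <= y1 t ^ 2 + 2 * l ^ 2 * y t ^ 2).
  { intros t Ht.
    assert (H := energy_backward (m ^ 2) l p 0 b t (fun t => c t - 1) (fun _ => 0)
      y y1 Ht ltac:(lra) Hp (Rle_refl 0) HQ).
    cbv beta in H. rewrite Hyb, Hy1b, Hwb, Hw1b in H.
    assert (HF : exp X <= exp (2 * (l * 0 + p) * (t - b))
      * (y1 t ^ 2 + (m ^ 2 + l ^ 2 * (c t - 1)) * y t ^ 2)).
    { eapply Rle_trans; [|apply H].
      - right. ring.
      - intros s _. apply Hc4.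
      - intros s r Hs Hr. replace (c s - 1 - (c r - 1)) with (c s - c r) by ring.
        apply Hcb; lra.
      - intros s _. rewrite Rabs_R0. lra.
      - intros s _. apply Hy.
      - intros s _. rewrite Rplus_0_r. apply Hy1. }
    assert (HF2 : y1 t ^ 2 + (m ^ 2 + l ^ 2 * (c t - 1)) * y t ^ 2 <= y1 t ^ 2 + 2 * l ^ 2 * y t ^ 2).
    { apply Rplus_le_compat_l, Rmult_le_compat_r; [apply pow2_ge_0|].
      specialize (Hc4 t). apply Rabs_le_between in Hc4.
      assert (0 <= l ^ 2) by apply pow2_ge_0. nra. }
    apply (Rmult_le_reg_l (exp (2 * p * t))); [apply exp_pos|].
    rewrite <- exp_plus. replace (2 * p * t + (X - 2 * p * t)) with X by ring.
    eapply Rle_trans; [exact HF|].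
    assert (Hnn : 0 <= y1 t ^ 2 + 2 * l ^ 2 * y t ^ 2).
    { assert (0 <= y1 t ^ 2) by apply pow2_ge_0. assert (0 <= y t ^ 2) by apply pow2_ge_0.
      assert (0 <= l ^ 2) by apply pow2_ge_0. nra. }
    eapply Rle_trans; [apply Rmult_le_compat_l; [left; apply exp_pos|exact HF2]|].
    apply Rmult_le_compat_r; [exact Hnn|]. apply exp_le. nra. }
  exists (fun t => exp (- d * t) * y t), (fun t => exp (- d * t) * (y1 t - d * y t)).
  assert (Ey : forall t, Derive (fun x : R => y x) t = y1 t)
    by (intros t; exact (is_derive_unique _ _ _ (Hy t))).
  assert (Ey1 : forall t, Derive (fun x : R => y1 x) t = - (m ^ 2 + l ^ 2 * (c t - 1)) * y t)
    by (intros t; exact (is_derive_unique _ _ _ (Hy1 t))).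
  split; [|split; [|split; [|split]]].
  - intros t. auto_derive; [now exists (y1 t)|]. rewrite Ey. ring.
  - intros t. auto_derive; [split; [eexists; apply Hy1|split; [eexists; apply Hy|exact I]]|].
    rewrite Ey, Ey1, Hm2. ring.
  - rewrite Rmult_0_r, exp_0, Rmult_1_l.
    assert (0 <= y1 0 ^ 2) by apply pow2_ge_0. assert (0 <= y 0 ^ 2) by apply pow2_ge_0.
    (* From [1 + l <= 2 l <= 4 m] and [m ^ 2 >= 3 l ^ 2 / 4]; with the factor 3 of [Hstart] this is
       the source of 16. *)
    assert ((1 + l) ^ 2 <= 16 / 3 * m ^ 2) by nra.
    nra.
  - rewrite Rmult_0_r, exp_0, Rmult_1_l.
    assert (0 <= (y1 0 + d * y 0) ^ 2) by apply pow2_ge_0.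
    assert (0 <= y 0 ^ 2) by apply pow2_ge_0.
    assert (d ^ 2 <= m ^ 2) by nra.
    assert (Hp0 := exp_pos (- X)). nra.
  - intros t Ht. specialize (Hend t Ht).
    set (E := exp (- d * t)).
    assert (HE : exp (2 * d * t) * (E * E) = 1).
    { unfold E. rewrite <- !exp_plus, <- exp_0. f_equal. ring. }
    assert (HE0 : 0 < E * E) by (apply Rmult_lt_0_compat; apply exp_pos).
    apply (Rmult_le_reg_l (exp (2 * d * t))); [apply exp_pos|].
    rewrite <- exp_plus.
    replace (2 * d * t + (X - (2 * p + 2 * d) * t)) with (X - 2 * p * t) by ring.
    eapply Rle_trans; [exact Hend|].
    replace (exp (2 * d * t) * (3 * ((1 + l) ^ 2 * (E * y t) ^ 2 + (E * (y1 t - d * y t)) ^ 2)))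
      with (exp (2 * d * t) * (E * E) * (3 * ((1 + l) ^ 2 * y t ^ 2 + (y1 t - d * y t) ^ 2))) by ring.
    rewrite HE, Rmult_1_l.
    assert (0 <= y t ^ 2) by apply pow2_ge_0.
    (* Equivalent to [y1 ^ 2 <= 2 (y1 - d y) ^ 2 + 2 d ^ 2 y ^ 2]. *)
    assert (0 <= (y1 t - 2 * (d * y t)) ^ 2) by apply pow2_ge_0.
    assert (d ^ 2 * y t ^ 2 <= l ^ 2 / 4 * y t ^ 2) by (apply Rmult_le_compat_r; nra).
    assert (l ^ 2 * y t ^ 2 <= (1 + l) ^ 2 * y t ^ 2) by (apply Rmult_le_compat_r; nra).
    nra.
Qed.

(** * The propagation speed and the solution *)

Lemma Series_diff_geom_bound (f h : nat -> R) (C : R) :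
  ex_series f -> ex_series h ->
  (forall n, Rabs (f n - h n) <= C * (1 / 2) ^ S n) -> Rabs (Series f - Series h) <= C.
Proof.
  intros Hf Hh HC. rewrite <- Series_minus by assumption.
  now apply (Series_geom_bound (fun n => f n - h n)).
Qed.

Lemma half_pow_antitone (i j : nat) : (i <= j)%nat -> (1 / 2) ^ j <= (1 / 2) ^ i.
Proof.
  intros Hij. induction Hij as [|j Hij IH]; [lra|].
  assert (0 < (1 / 2) ^ j) by (apply pow_lt; lra). simpl. lra.
Qed.

Lemma two_pow_half_pow (k : nat) : 2 ^ k * (1 / 2) ^ k = 1.
Proof.
  rewrite <- Rpow_mult_distr. replace (2 * (1 / 2)) with 1 by field. apply pow1.
Qed.

Lemma two_pow_eventually_ge (x : R) : exists k0, forall k, (k0 <= k)%nat -> x <= 2 ^ k.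
Proof.
  destruct (Pow_x_infinity 2 ltac:(rewrite Rabs_right; lra) x) as [k0 Hk0].
  exists k0. intros k Hk. specialize (Hk0 k Hk).
  rewrite Rabs_right in Hk0; [lra|]. apply Rle_ge, pow_le. lra.
Qed.

(** The supports overlap at most at end points. Before the interval of mode [k] only later modes
    act, and they are small against [1 / l k]; after [b k] only earlier ones act, with Lipschitz
    constant [p k]. The weights [(1 / 2) ^ S k] allow summation without locating [t] and [s]. *)
Lemma dyadic_speed (omega : R -> R) (g : nat -> R -> R) (b l p : nat -> R) :
  continuity_modulus omega ->
  (forall k, (1 / 2) ^ S k <= b k <= (1 / 2) ^ k) ->
  (forall k t, t <= (1 / 2) ^ S k -> g k t = 0) ->
  (forall k t, b k <= t -> g k t = 0) ->
  (forall k t, Rabs (g k t) <= 1 / 4 * (1 / 2) ^ S k) ->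
  (forall j k t, (j < k)%nat -> Rabs (g k t) <= 1 / l j * (1 / 2) ^ S k) ->
  (forall k t s, Rabs (g k t - g k s) <= omega (Rabs (t - s)) * (1 / 2) ^ S k) ->
  (forall j k t s, (j < k)%nat ->
     Rabs (g j t - g j s) <= p k * Rabs (t - s) * (1 / 2) ^ S j) ->
  (forall k, 0 < l k) -> (forall k, 0 <= p k) ->
  let c t := 1 + Series (fun k => g k t) in
  (forall t, Rabs (c t - 1) <= 1 / 4) /\
  (forall t s, Rabs (c t - c s) <= omega (Rabs (t - s))) /\
  (forall t, continuity_pt c t) /\
  (forall k t, t <= (1 / 2) ^ S k -> Rabs (c t - 1) <= 1 / l k) /\
  (forall k t, (1 / 2) ^ S k <= t <= b k -> c t - 1 = g k t) /\
  (forall k t s, b k <= t -> b k <= s -> Rabs (c t - c s) <= p k * Rabs (t - s)).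
Proof.
  intros Hom Hb Hleft Hright Hquart Hsmall Hmod Hlip Hl Hp c.
  assert (Hc1 : forall t, c t - 1 = Series (fun k => g k t)) by (intros t; unfold c; ring).
  assert (Hcd : forall t s, c t - c s = Series (fun k => g k t) - Series (fun k => g k s))
    by (intros t s; unfold c; ring).
  assert (Hex : forall t, ex_series (fun k => g k t))
    by (intros t; apply (Series_geom_bound _ (1 / 4)); auto).
  assert (Hpow : forall k, 0 < (1 / 2) ^ k) by (intros k; apply pow_lt; lra).
  assert (Hcmod : forall t s, Rabs (c t - c s) <= omega (Rabs (t - s))).
  { intros t s. rewrite Hcd. now apply Series_diff_geom_bound. }
  split; [|split; [|split; [|split; [|split]]]].
  - intros t. rewrite Hc1. now apply Series_geom_bound.
  - exact Hcmod.
  - intros t eta Heta.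
    destruct (modulus_small omega eta Hom Heta) as [d [Hd Hsm]].
    exists d. split; [exact Hd|]. intros s [_ Hs].
    apply Rle_lt_trans with (omega (Rabs (s - t))); [apply Hcmod|].
    apply Hsm. split; [apply Rabs_pos|exact Hs].
  - intros k t Ht. rewrite Hc1. apply Series_geom_bound.
    intros j. destruct (Nat.le_gt_cases j k) as [Hjk|Hkj]; [|now apply Hsmall].
    rewrite Hleft, Rabs_R0.
    + apply Rmult_le_pos; [|left; apply Hpow].
      left. apply Rdiv_lt_0_compat; [lra|apply Hl].
    + eapply Rle_trans; [exact Ht|]. apply half_pow_antitone. lia.
  - intros k t Ht. rewrite Hc1. apply (Series_eq_single (fun j => g j t) k).
    intros j Hj. destruct (Nat.le_gt_cases j k) as [Hjk|Hkj].
    + apply Hleft. apply Rle_trans with ((1 / 2) ^ k).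
      * specialize (Hb k). lra.
      * apply half_pow_antitone. lia.
    + apply Hright. apply Rle_trans with ((1 / 2) ^ j); [apply Hb|].
      apply Rle_trans with ((1 / 2) ^ S k); [|apply Ht]. apply half_pow_antitone. lia.
  - intros k t s Ht Hs. rewrite Hcd. apply Series_diff_geom_bound; [apply Hex|apply Hex|].
    intros j. destruct (Nat.le_gt_cases k j) as [Hkj|Hjk]; [|now apply Hlip].
    assert (Hbjk : b j <= b k).
    { destruct (Nat.eq_dec j k) as [->|Hne]; [lra|].
      apply Rle_trans with ((1 / 2) ^ j); [apply Hb|].
      apply Rle_trans with ((1 / 2) ^ S k); [|apply Hb]. apply half_pow_antitone. lia. }
    rewrite 2!Hright, Rminus_diag, Rabs_R0 by lra.
    apply Rmult_le_pos; [|left; apply Hpow].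
    apply Rmult_le_pos; [apply Hp|apply Rabs_pos].
Qed.

Lemma Rpower_ge_1 (x s : R) : 1 <= x -> 0 <= s -> 1 <= Rpower x s.
Proof.
  intros Hx Hs. unfold Rpower. rewrite <- exp_0. apply exp_le.
  apply Rmult_le_pos; [exact Hs|]. rewrite <- ln_1.
  destruct Hx as [Hx| <-]; [left; apply ln_increasing; lra|lra].
Qed.

Lemma Rpower_four_half (x : R) : 0 < x -> Rpower x (4 * (1 / 2)) = x ^ 2.
Proof.
  intros Hx. rewrite <- Rpower_pow by exact Hx. f_equal. simpl. field.
Qed.

Lemma Rpower_four_zero (x : R) : 0 < x -> Rpower x (4 * 0) = 1.
Proof.
  intros Hx. rewrite Rmult_0_r. now apply Rpower_O.
Qed.

(** * Construction of the speed and of the solution *)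

Theorem theorem3p10
  (H : CompleteNormedModule R_AbsRing) (ip : H -> H -> R)
  (Hip : is_inner_product H ip)
  (A : linear_operator H)
  (e : nat -> H) (lambda : nat -> R)
  (He : orthonormal ip e)
  (Hlambda_pos : forall k, 0 < lambda k)
  (Hlambda_unb : unbounded_seq lambda)
  (HA : forall k, dom A (e k) /\ op A (e k) = scal (lambda k ^ 2) (e k))
  (sigma delta : R)
  (Hsigma : 0 <= sigma < 1 / 2)
  (Hdelta : 0 < delta)
  (omega : R -> R)
  (Homega : continuity_modulus omega)
  (Homega_lim :
    filterlim (fun eps => omega eps / Rpower eps (1 - 2 * sigma))
      (at_right 0) (Rbar_locally p_infty))
  (phi psi : R -> R)
  (Hphi : forall x, 0 < x -> 0 < phi x)
  (Hpsi : forall x, 0 < x -> 0 < psi x)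
  (Hphi_lim : is_lim (fun x => x / phi x * omega (1 / x)) p_infty p_infty)
  (Hpsi_lim : is_lim (fun x => x / psi x * omega (1 / x)) p_infty p_infty) :
  exists (c : R -> R) (u : nat -> R -> R),
    (forall t, 1 / 2 <= c t <= 3 / 2) /\
    (forall t s, Rabs (c t - c s) <= omega (Rabs (t - s))) /\
    is_solution delta sigma lambda c u /\
    (forall r, 0 < r ->
       gevrey lambda phi r (1 / 2) (fun k => u k 0) /\
       gevrey lambda phi r 0 (fun k => Derive (u k) 0)) /\
    (forall r t, 0 < r -> 0 < t ->
       ~ (gevrey_ultra lambda psi r (1 / 2) (fun k => u k t) /\
          gevrey_ultra lambda psi r 0 (fun k => Derive (u k) t))).
Proof.
  (* The part with 2560 feeds [resonance_parameters]; the part with [2 * delta] forces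
     [d k <= l k / 2], so each excited mode still oscillates. *)
  set (M := fun k p => (2560 + 2 * delta) * 8 ^ k * p).
  destruct (subsequence_selection
    (* The guard makes [M k p] positive; [Hp1] discharges it by induction, since selected
       frequencies are at least 2560. *)
    (fun k p x => 1 <= p -> resonant_frequency (2 * sigma) omega phi psi (M k p) x)
    lambda Hlambda_unb) as [n [Hn HP]].
  { intros k p. destruct (Rle_dec 1 p) as [Hp|Hp]; [|exists 0; intros; lra].
    assert (HM : 0 < M k p).
    { unfold M. repeat apply Rmult_lt_0_compat; try lra. apply pow_lt; lra. }
    destruct (resonant_frequency_eventually (2 * sigma) omega phi psi (M k p)) as [X HX]; auto.
    exists X. intros x Hx _. now apply HX. }
  set (p := previous_value lambda n) in *.
  set (l := fun k => lambda (n k)).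
  set (w := fun k => omega (1 / l k)).
  set (d := fun k => delta * Rpower (l k) (2 * sigma)).
  (* Everything the growth exponent must beat; multiplied by [p k], the summand 1 covers the loss
     due to the Lipschitz constant of [c]. *)
  set (load := fun k => 1 + Rpower (l k) (2 * sigma) + phi (l k) + psi (l k)).
  assert (H8 : forall k, 1 <= 8 ^ k) by (intros k; apply pow_R1_Rle; lra).
  assert (HMp : forall k q, 1 <= q -> 2560 * 8 ^ k * q <= M k q /\ 2 * delta <= M k q
                 /\ 2560 <= M k q /\ q <= M k q).
  { intros k q Hq. unfold M. specialize (H8 k).
    assert (1 <= 8 ^ k * q) by nra. assert (q <= 8 ^ k * q) by nra.
    rewrite !Rmult_assoc. split; [|split; [|split]]; nra. }
  assert (Hp1 : forall k, 1 <= p k).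
  { intros k. induction k as [|k IH]; [simpl; lra|].
    destruct (HP k IH) as [HMl _ _ _ _]. destruct (HMp k (p k) IH) as [_ [_ [HM _]]].
    change (p (S k)) with (lambda (n k)). lra. }
  assert (Hrf : forall k, resonant_frequency (2 * sigma) omega phi psi (M k (p k)) (l k))
    by (intros k; exact (HP k (Hp1 k))).
  assert (Hl1 : forall k, 1 <= l k) by (intros k; exact (Hp1 (S k))).
  assert (Hw : forall k, 0 < w k)
    by (intros k; apply (cm_pos _ Homega), Rdiv_lt_0_compat; [lra|apply Hlambda_pos]).
  assert (HMw : forall k, 0 <= w k <= 1 / 2560 /\ p k * w k <= 1).
  { intros k. specialize (Hw k). destruct (Hrf k) as [_ Hs _ _ _]. fold (w k) in Hs.
    destruct (HMp k (p k) (Hp1 k)) as [_ [_ [HM HMq]]].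
    split; nra. }
  assert (HR1 : forall k, 1 <= Rpower (l k) (2 * sigma))
    by (intros k; apply Rpower_ge_1; [apply Hl1|lra]).
  assert (Hd : forall k, 0 <= d k <= l k / 2).
  { intros k. specialize (HR1 k). destruct (Hrf k) as [_ _ Hs _ _]. fold (w k) in Hs.
    destruct (HMp k (p k) (Hp1 k)) as [_ [HM _]]. specialize (HMw k). specialize (Hl1 k).
    unfold d. split; nra. }
  assert (Hpl : forall i j, (i < j)%nat -> l i <= p j).
  { assert (Hpp : forall k, p k <= l k).
    { intros k. destruct (Hrf k) as [Hs _ _ _ _].
      destruct (HMp k (p k) (Hp1 k)) as [_ [_ [_ HM]]]. lra. }
    intros i j Hij. induction Hij as [|j Hij IH]; [apply Rle_refl|].
    eapply Rle_trans; [exact IH|apply Hpp]. }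
  assert (Hpar : forall k, exists mb : R * R,
    l k / 2 <= fst mb <= l k /\ fst mb ^ 2 = l k ^ 2 - d k ^ 2 /\
    (1 / 2) ^ S k <= snd mb <= (1 / 2) ^ k /\
    sin (fst mb * (snd mb - (1 / 2) ^ S k)) = 0 /\
    2 ^ k * p k * load k
    <= 2 * ((1 / 2) ^ S k * w k / 80) * fst mb * (snd mb - (1 / 2) ^ S k)).
  { intros k. destruct (HMp k (p k) (Hp1 k)) as [HM _].
    destruct (Hrf k) as [R1 R2 R3 R4 R5]. fold (w k) in R2, R3, R4, R5.
    specialize (Hw k). specialize (HR1 k).
    assert (Hph := Hphi _ (Hlambda_pos (n k))). assert (Hps := Hpsi _ (Hlambda_pos (n k))).
    fold (l k) in Hph, Hps.
    assert (HM0 : 0 <= 2560 * 8 ^ k * p k).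
    { specialize (H8 k). specialize (Hp1 k). nra. }
    destruct (resonance_parameters k (p k) (l k) (d k) (w k) (load k)) as [m [b Hmb]];
      auto; try lra.
    - nra.
    - apply Rle_trans with (M k (p k) * load k); [apply Rmult_le_compat_r; [unfold load; lra|exact HM]|].
      unfold load. assert (M k (p k) <= M k (p k) * Rpower (l k) (2 * sigma)) by nra. lra.
    - now exists (m, b). }
  destruct (functional_choice _ Hpar) as [mb Hmb]. clear Hpar.
  set (m := fun k => fst (mb k)) in *. set (b := fun k => snd (mb k)) in *.
  change (forall k, l k / 2 <= m k <= l k /\ m k ^ 2 = l k ^ 2 - d k ^ 2 /\
    (1 / 2) ^ S k <= b k <= (1 / 2) ^ k /\ sin (m k * (b k - (1 / 2) ^ S k)) = 0 /\
    2 ^ k * p k * load k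
    <= 2 * ((1 / 2) ^ S k * w k / 80) * m k * (b k - (1 / 2) ^ S k)) in Hmb.
  (* The divisor 80 cancels the constants of [bump_modulus] and [bump_lipschitz], leaving exactly
     the weight [(1 / 2) ^ S k]. *)
  set (eps := fun k => (1 / 2) ^ S k * w k / 80) in *.
  set (g := fun k => bump (l k) (m k) ((1 / 2) ^ S k) (b k) (eps k)).
  assert (Hpow : forall k, 0 < (1 / 2) ^ k <= 1).
  { intros k. split; [apply pow_lt; lra|]. apply (half_pow_antitone 0 k). lia. }
  assert (Heps : forall k, 0 <= eps k <= 1).
  { intros k. unfold eps. specialize (Hpow (S k)). destruct (HMw k) as [H1 _]. split; nra. }
  assert (Hm0 : forall k, 0 < m k)
    by (intros k; destruct (Hmb k) as [[H1 _] _]; specialize (Hl1 k); lra).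
  destruct (dyadic_speed omega g b l p) as [Hc4 [Hcw [Hcc [Hca [Hcab Hcb]]]]].
  - exact Homega.
  - intros k. apply Hmb.
  - intros k t Ht. destruct (Hmb k) as [? [? [? [? ?]]]]. apply bump_before; lra.
  - intros k t Ht. destruct (Hmb k) as [? [? [? [? ?]]]]. apply bump_after; lra.
  - intros k t. destruct (Hmb k) as [? [? [? [? ?]]]].
    eapply Rle_trans; [apply bump_bound; auto; lra|].
    unfold eps. specialize (Hpow (S k)). destruct (HMw k) as [Hw1 _]. nra.
  - intros j k t Hjk. destruct (Hmb k) as [? [? [? [? ?]]]].
    eapply Rle_trans; [apply bump_bound; auto; lra|].
    (* Then [w k <= 1 / p k <= 1 / l j], as [p k] dominates all earlier frequencies. *)
    apply Rle_trans with (w k * (1 / 2) ^ S k).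
    + unfold eps. specialize (Hpow (S k)). specialize (Hw k). nra.
    + apply Rmult_le_compat_r; [left; apply Hpow|].
      specialize (Hpl j k Hjk). destruct (HMw k) as [_ Hw1]. specialize (Hl1 j). specialize (Hw k).
      apply (Rmult_le_reg_l (l j)); [lra|].
      replace (l j * (1 / l j)) with 1 by (field; lra). nra.
  - intros k t s. destruct (Hmb k) as [? [? [? [? ?]]]].
    apply (Rmult_le_reg_l (w k)); [apply Hw|].
    eapply Rle_trans; [apply bump_modulus; auto; lra|].
    unfold eps. right. field.
  - intros j k t s Hjk. destruct (Hmb j) as [? [? [? [? ?]]]].
    eapply Rle_trans; [apply bump_lipschitz; auto; lra|].
    replace (80 * eps j * l j * Rabs (t - s))
      with (w j * l j * Rabs (t - s) * (1 / 2) ^ S j) by (unfold eps; field).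
    apply Rmult_le_compat_r; [left; apply Hpow|].
    apply Rmult_le_compat_r; [apply Rabs_pos|].
    specialize (Hpl j k Hjk). destruct (HMw j) as [Hw1 _]. specialize (Hl1 j). nra.
  - intros k. apply Hlambda_pos.
  - intros k. specialize (Hp1 k). lra.
  - set (c := fun t => 1 + Series (fun k => g k t)) in *.
    set (X := fun k => 2 * eps k * m k * (b k - (1 / 2) ^ S k)) in *.
    set (mode := fun k (u : R -> R) => exists u1 : R -> R,
      (forall t, is_derive u t (u1 t)) /\
      (forall t, is_derive u1 t (- 2 * d k * u1 t - l k ^ 2 * c t * u t)) /\
      (1 + l k) ^ 2 * u 0 ^ 2 <= 16 * exp (- X k) /\ u1 0 ^ 2 <= 16 * exp (- X k) /\
      (forall t, b k <= t ->
        exp (X k - (2 * p k + 2 * d k) * t) <= 3 * ((1 + l k) ^ 2 * u t ^ 2 + u1 t ^ 2))).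
    assert (Hmode : forall k, exists u, mode k u).
    { intros k. destruct (Hmb k) as [? [? [? [? ?]]]].
      apply (resonant_mode_exists (l k) (d k) (m k) ((1 / 2) ^ S k) (b k) (eps k) (p k) c);
        auto; try lra.
      - assert (Hk1 := Hpow (S k)). assert (Hk := Hpow k). simpl in *. lra.
      - specialize (Hp1 k). lra.
      - intros t Ht. apply Hca. lra.
      - exact (Hcab k).
      - exact (Hcb k). }
    assert (HU : forall j, exists u : R -> R,
      (forall k, j = n k -> mode k u) /\ ((forall k, j <> n k) -> forall t, u t = 0)).
    { intros j. destruct (classic (exists k, j = n k)) as [[k ->]|Hj].
      - destruct (Hmode k) as [u Hu]. exists u. split.
        + intros i Hi. enough (i = k) by now subst i.
          assert (Hlt := strictly_increasing_lt n Hn).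
          destruct (Nat.lt_trichotomy i k) as [Hik|[Hik|Hik]]; [|exact Hik|];
            specialize (Hlt _ _ Hik); lia.
        + intros Hk. now destruct (Hk k).
      - exists (fun _ => 0). split; [|reflexivity].
        intros k Hk. exfalso. apply Hj. now exists k. }
    destruct (functional_choice _ HU) as [u Hu]. clear HU Hmode.
    assert (HXk : forall k, 2 ^ k * p k * load k <= X k) by (intros k; apply Hmb).
    assert (Hder0 : forall j t, (forall k, j <> n k) -> Derive (u j) t = 0).
    { intros j t Hj. rewrite (Derive_ext _ (fun _ => 0)); [apply Derive_const|].
      now apply (Hu j). }
    exists c, u. split; [|split; [exact Hcw|split; [|split]]].
    + intros t. assert (Ht : Rabs (c t - 1) <= 1 / 4) by exact (Hc4 t).
      apply Rabs_le_between in Ht. lra.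
    + intros j t _.
      enough (exists u1 : R -> R, (forall t, is_derive (u j) t (u1 t)) /\
        (forall t, is_derive u1 t
           (- 2 * delta * Rpower (lambda j) (2 * sigma) * u1 t - lambda j ^ 2 * c t * u j t)))
        as [u1 [H1 H2]].
      { assert (E : forall t, Derive (u j) t = u1 t) by (intros z; apply is_derive_unique, H1).
        assert (H3 : is_derive (Derive (u j)) t
          (- 2 * delta * Rpower (lambda j) (2 * sigma) * u1 t - lambda j ^ 2 * c t * u j t)).
        { apply (is_derive_ext u1); [intros z; now rewrite E|apply H2]. }
        split; [now exists (u1 t)|split; [eexists; exact H3|]].
        rewrite (is_derive_unique _ _ _ H3), E. ring. }
      destruct (classic (exists k, j = n k)) as [[k Hk]|Hj].
      * destruct (Hu j) as [Huj _]. destruct (Huj k Hk) as [u1 [H1 [H2 _]]].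
        exists u1. split; [exact H1|]. intros z. rewrite Hk at 1 2.
        replace (- 2 * delta * Rpower (lambda (n k)) (2 * sigma) * u1 z)
          with (- 2 * d k * u1 z) by (unfold d, l; ring).
        apply H2.
      * assert (Hj' : forall k, j <> n k) by (intros k Hk; apply Hj; now exists k).
        destruct (Hu j) as [_ Huj].
        exists (fun _ => 0). split; intros z.
        -- apply (is_derive_ext (fun _ => 0)); [intros x; now rewrite Huj|].
           apply (is_derive_const (V := R_NormedModule) 0).
        -- rewrite Huj, 2!Rmult_0_r, Rminus_0_r by exact Hj'.
           apply (is_derive_const (V := R_NormedModule) 0).
    + intros r Hr.
      (* Once [2 ^ k >= 2 r], the bound [X k >= 2 ^ k (1 + phi (l k))] leaves at least [2 ^ k] in
         the exponent, and [exp (- 2 ^ k) <= (1 / 2) ^ k]. *)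
      destruct (two_pow_eventually_ge (2 * r)) as [k0 Hk0].
      assert (Hsum : forall (al : R) (v : nat -> R), (forall j, (forall k, j <> n k) -> v j = 0) ->
        (forall k, Rpower (1 + l k) (4 * al) * v (n k) ^ 2 <= 16 * exp (- X k)) ->
        gevrey lambda phi r al v).
      { intros al v Hv0 Hv. apply (ex_series_sparse _ n 16 k0).
        - intros j. apply Rmult_le_pos; [|left; apply exp_pos].
          apply Rmult_le_pos; [left; apply exp_pos|apply pow2_ge_0].
        - exact Hn.
        - intros j Hj. rewrite (Hv0 j Hj). ring.
        - intros k Hk.
          apply Rle_trans with (16 * exp (- X k) * exp (2 * r * phi (l k))).
          { apply Rmult_le_compat_r; [left; apply exp_pos|apply Hv]. }
          rewrite Rmult_assoc, <- exp_plus. apply Rmult_le_compat_l; [lra|].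
          apply Rle_trans with (exp (- 2 ^ k)).
          + apply exp_le. specialize (Hk0 k Hk). specialize (HXk k). specialize (Hp1 k).
            specialize (HR1 k).
            assert (Hph := Hphi _ (Hlambda_pos (n k))). assert (Hps := Hpsi _ (Hlambda_pos (n k))).
            fold (l k) in Hph, Hps.
            assert (H2k : 0 < 2 ^ k) by (apply pow_lt; lra).
            assert (HS : 2 ^ k * (1 + phi (l k)) <= 2 ^ k * p k * load k).
            { rewrite Rmult_assoc. apply Rmult_le_compat_l; [lra|]. unfold load. nra. }
            nra.
          + assert (H2k := two_pow_half_pow k). assert (H2k0 : 0 < 2 ^ k) by (apply pow_lt; lra).
            apply (Rmult_le_reg_l (2 ^ k)); [exact H2k0|]. rewrite H2k.
            apply Rle_trans with (exp (2 ^ k) * exp (- 2 ^ k)).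
            * apply Rmult_le_compat_r; [left; apply exp_pos|].
              assert (H1 := exp_ineq1_le (2 ^ k)). lra.
            * right. rewrite <- exp_plus, Rplus_opp_r. apply exp_0. }
      split; apply Hsum.
      * intros j Hj. now apply (Hu j).
      * intros k. destruct (Hu (n k)) as [Huk _]. destruct (Huk k eq_refl) as [u1 [_ [_ [H1 _]]]].
        rewrite Rpower_four_half; [exact H1|]. specialize (Hl1 k). lra.
      * intros j Hj. now apply Hder0.
      * intros k. destruct (Hu (n k)) as [Huk _]. destruct (Huk k eq_refl) as [u1 [H0 [_ [_ [H1 _]]]]].
        rewrite Rpower_four_zero, (is_derive_unique _ _ _ (H0 0)), Rmult_1_l; [exact H1|].
        specialize (Hl1 k). lra.
    + intros r t Hr Ht [Hs1 Hs2].
      apply ex_series_lim_0, is_lim_seq_spec in Hs1. apply ex_series_lim_0, is_lim_seq_spec in Hs2.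
      (* Both general terms would tend to 0, whereas along the indices [n k] their sum is eventually
         at least 1/3. *)
      assert (H6 : 0 < 1 / 6) by lra.
      destruct (Hs1 (mkposreal _ H6)) as [N1 HN1]. destruct (Hs2 (mkposreal _ H6)) as [N2 HN2].
      simpl in HN1, HN2. clear Hs1 Hs2.
      (* The summands absorb, in order, the Lipschitz loss [2 p t], the damping loss [2 d t] and the
         weight [2 r psi]; the last one gives [(1 / 2) ^ k <= t], so the resonance of mode [k] is
         over at time [t]. *)
      destruct (two_pow_eventually_ge (2 * t + 2 * delta * t + 2 * r + / t)) as [k0 Hk0].
      set (k := (N1 + N2 + k0)%nat).
      assert (Hge : forall i, (i <= n i)%nat).
      { intros i. induction i as [|i IH]; [lia|]. specialize (Hn i). lia. }
      specialize (Hge k).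
      specialize (HN1 (n k) ltac:(lia)). specialize (HN2 (n k) ltac:(lia)).
      specialize (Hk0 k ltac:(lia)).
      rewrite Rminus_0_r in HN1, HN2. apply Rabs_lt_between in HN1. apply Rabs_lt_between in HN2.
      destruct (Hu (n k)) as [Huk _]. destruct (Huk k eq_refl) as [u1 [H0 [_ [_ [_ H1]]]]].
      fold (l k) in HN1, HN2. specialize (Hl1 k).
      rewrite Rpower_four_half in HN1 by lra.
      rewrite Rpower_four_zero, (is_derive_unique _ _ _ (H0 t)), Rmult_1_l in HN2 by lra.
      assert (Hit : 0 < / t) by now apply Rinv_0_lt_compat.
      assert (Hdt : 0 < delta * t) by now apply Rmult_lt_0_compat.
      assert (H2k := two_pow_half_pow k). assert (H2k0 : 0 < 2 ^ k) by (apply pow_lt; lra).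
      assert (Hbt : b k <= t).
      { apply Rle_trans with ((1 / 2) ^ k); [apply Hmb|].
        apply (Rmult_le_reg_l (2 ^ k)); [exact H2k0|]. rewrite H2k.
        assert (E : / t * t = 1) by (field; lra). nra. }
      specialize (H1 t Hbt).
      assert (HXr : 0 <= X k - (2 * p k + 2 * d k) * t - 2 * r * psi (l k)).
      { specialize (HXk k). specialize (Hp1 k). specialize (HR1 k).
        assert (Hph := Hphi _ (Hlambda_pos (n k))). assert (Hps := Hpsi _ (Hlambda_pos (n k))).
        fold (l k) in Hph, Hps.
        assert (E1 : 2 * t * p k <= 2 ^ k * p k) by (apply Rmult_le_compat_r; lra).
        assert (E2 : 2 * delta * t * Rpower (l k) (2 * sigma) <= 2 ^ k * Rpower (l k) (2 * sigma))
          by (apply Rmult_le_compat_r; lra).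
        assert (E3 : 2 * r * psi (l k) <= 2 ^ k * psi (l k)) by (apply Rmult_le_compat_r; lra).
        assert (HS : 2 ^ k * (p k + Rpower (l k) (2 * sigma) + psi (l k)) <= 2 ^ k * p k * load k).
        { rewrite Rmult_assoc. apply Rmult_le_compat_l; [lra|]. unfold load. nra. }
        unfold d. nra. }
      set (Z := exp (- 2 * r * psi (l k))) in *.
      assert (HZ : 1 <= exp (X k - (2 * p k + 2 * d k) * t) * Z).
      { unfold Z. rewrite <- exp_plus, <- exp_0. apply exp_le. lra. }
      assert (HZ0 : 0 < Z) by apply exp_pos.
      assert (HZ1 : exp (X k - (2 * p k + 2 * d k) * t) * Z
        <= 3 * ((1 + l k) ^ 2 * u (n k) t ^ 2 + u1 t ^ 2) * Z)
        by (apply Rmult_le_compat_r; lra).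
      lra.
Qed.
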